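(* Let $K\ge 3$, let $X_1,\dots,X_K$ be Polish spaces, let $\mu_k\in\mathcal P(X_k)$ for $k=1,\dots,K$, and let $c:X_1\times\cdots\times X_K\to\mathbb R$ be bounded and continuous. Then the dual problem $\sup_{\boldsymbol f\in\mathcal F_c}J(\boldsymbol f)$ admits a maximizer $(g_1,\dots,g_K)\in\mathcal F_c$ whose components are $c$-conjugate, i.e. $g_k\in c\text{-conj}(X_k)$ for each $k$. In particular, $$\mathsf{MOT}_c(\mu_1,\dots,\mu_K)=\max_{\boldsymbol f\in\mathcal F_c}J(\boldsymbol f)=\max_{\boldsymbol f\in\mathcal F_c\cap\prod_{k=1}^K c\text{-conj}(X_k)}J(\boldsymbol f),$$ and this common value coincides with $\min_{\pi\in\Pi(\mu_1,\dots,\mu_K)}\int c\,d\pi$ (the minimum being attained).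
   Context: $\mathcal P(X)$ is the set of Borel probability measures on $X$. $\Pi(\mu_1,\dots,\mu_K)$ is the set of $\pi\in\mathcal P(X_1\times\cdots\times X_K)$ whose $k$-th marginal is $\mu_k$ for every $k$, and $\mathsf{MOT}_c(\mu_1,\dots,\mu_K)=\inf_{\pi\in\Pi(\mu_1,\dots,\mu_K)}\int c\,d\pi$. For a family $\boldsymbol f=(f_1,\dots,f_K)$ with $f_k\in L^1(\mu_k)$, define $J(\boldsymbol f)=\sum_{k=1}^K\int_{X_k}f_k\,d\mu_k$. The admissible class $\mathcal F_c$ is the set of families $\boldsymbol f=(f_1,\dots,f_K)$ such that each $f_k:X_k\to\mathbb R$ is Borel with $f_k\in L^1(\mu_k)$, and $\sum_{k=1}^K f_k(x_k)\le c(x_1,\dots,x_K)$ for all $(x_1,\dots,x_K)$. The class $c\text{-conj}(X_k)$ is the set of functions $f_k:X_k\to\mathbb R$ for which there exist functions $h_l:X_l\to\mathbb R$, $l\ne k$, such that for all $x_k\in X_k$ $$f_k(x_k)=\inf_{(x_l)_{l\ne k}\in\prod_{l\neq k}X_l}\Big\{c(x_1,\dots,x_K)-\sum_{l\ne k}h_l(x_l)\Big\}.$$ *)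

(* Defs.v *)
(* MathComp-Analysis. *)
From HB Require Import structures.
From mathcomp Require Import all_boot all_order all_algebra.
From mathcomp Require Import all_classical all_reals all_analysis.

Set Implicit Arguments.
Unset Strict Implicit.
Unset Printing Implicit Defensive.

Import Order.TTheory GRing.Theory Num.Theory.
Import numFieldNormedType.Exports.

Local Open Scope classical_set_scope.
Local Open Scope ring_scope.

(* Separable and completely metrizable; the metric is existentially quantified,
   so that only the topology of T matters. *)
Definition polish (R : realType) (T : topologicalType) : Prop :=
  (exists2 D : set T, countable D & dense D) /\
  exists d : T -> T -> R,
    [/\ forall x y, (d x y = 0) <-> (x = y),
        forall x y, d x y = d y x,
        forall x y z, d x z <= d x y + d y z,
        forall (x : T) (A : set T),
          nbhs x A <-> exists2 e : R, 0 < e & [set y | d x y < e] `<=` A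
      & forall u : nat -> T,
          (forall e : R, 0 < e -> exists N, forall m n,
             (N <= m)%N -> (N <= n)%N -> d (u m) (u n) < e) ->
          exists l : T, u @ \oo --> l].

(* Measurable types are pointed, whence ptopologicalType below; a space that
   carries a probability measure is nonempty anyway. *)
Notation borel T := (g_sigma_algebraType (@open T)).

Definition is_maximum (R : realType) (S : set (\bar R)) (m : \bar R) : Prop :=
  S m /\ ubound S m.

Definition is_minimum (R : realType) (S : set (\bar R)) (m : \bar R) : Prop :=
  S m /\ lbound S m.

Section multimarginal.
Context {R : realType} {K : nat} {X : 'I_K -> ptopologicalType}.
Variable mu : forall k, probability (borel (X k)) R.
Variable c : prod_topology X -> R.

(* The sigma-algebra is the Borel one of the product topology. *)
Definition couplings : set (probability (borel (prod_topology X)) R) :=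
  [set pi | forall (k : 'I_K) (A : set (borel (X k))), measurable A ->
     pushforward pi (fun x : borel (prod_topology X) => x k : borel (X k)) A
     = mu k A].

Definition cost (pi : probability (borel (prod_topology X)) R) : \bar R :=
  (\int[pi]_x (c x)%:E)%E.

Definition MOT : \bar R := ereal_inf (cost @` couplings).

Definition J (f : forall k, X k -> R) : \bar R :=
  (\sum_(k < K) \int[mu k]_x (f k x)%:E)%E.

Definition admissible : set (forall k, X k -> R) :=
  [set f | (forall k, measurable_fun [set: borel (X k)] (f k)) /\
           (forall k, (mu k).-integrable [set: borel (X k)] (EFin \o f k)) /\
           (forall x : prod_topology X, \sum_(k < K) f k (x k) <= c x)].

(* The family (x_l), l != k, is encoded as a point y of the whole product with
   y k = x; the component h k is not used. The infimum is taken in \bar R, so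
   that the equation forces it to be finite. *)
Definition c_conj (k : 'I_K) : set (X k -> R) :=
  [set f | exists h : forall l, X l -> R, forall x : X k,
     (f x)%:E =
     ereal_inf [set (c y - \sum_(l < K | l != k) h l (y l))%:E
               | y in [set y : prod_topology X | y k = x]]].

Definition all_c_conj : set (forall k, X k -> R) :=
  [set f | forall k, c_conj (f k)].

End multimarginal.

(* Main.v *)
(* Let L be a linear functional on the bounded functions of (x_1, ..., x_K) lying below the
   superhedging price U(u) = inf { J(f) : sum_k f_k(x_k) >= u } and with L(-c) = U(-c), so that
   L(c) is at most the dual value (Hahn-Banach).  The set function A |-> L(1_A) is finitely
   additive, has the marginals mu_k on cylinders, and is tight because each mu_k is (Ulam).  As in
   the Riesz representation theorem, its compact inner content generates a Borel probability pi
   with pi(O) <= L(1_O) for every open O.  On opens the marginals of pi are therefore below the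
   mu_k, hence equal to them, and summing over the levels of c gives int c dpi <= L(c).  With weak
   duality this makes pi optimal and closes the duality gap.

   For the dual maximizer, truncation makes a maximizing sequence uniformly bounded.  Choosing it
   with nearly minimal L^2 norm, the parallelogram identity makes it L^1-Cauchy, with summable
   increments.  The pointwise lower limits phi_k still satisfy sum_k phi_k <= c everywhere, since
   lower limits are superadditive, and lose nothing in the integrals.  Replacing the coordinates
   one after the other by their c-transforms, which are upper semicontinuous and hence Borel, only
   increases them. *)
Require Import Defs.
From HB Require Import structures.
From mathcomp Require Import all_boot all_order all_algebra.
From mathcomp Require Import all_classical all_reals all_analysis.
From mathcomp Require Import measurable_realfun finmap ring lra.

Set Implicit Arguments.
Unset Strict Implicit.
Unset Printing Implicit Defensive.

Import Order.TTheory GRing.Theory Num.Theory.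
Import numFieldNormedType.Exports.

Local Open Scope classical_set_scope.
Local Open Scope ring_scope.

(** * Hahn-Banach *)

Lemma le_infD (R : realType) (A B : set R) (x : R) : A !=set0 -> B !=set0 ->
  (forall a b, A a -> B b -> x <= a + b) -> x <= inf A + inf B.
Proof.
move=> A0 B0 xAB; rewrite -lerBlDr; apply: lb_le_inf => // a Aa.
rewrite lerBlDr -lerBlDl; apply: lb_le_inf => // b Bb.
by rewrite lerBlDl xAB.
Qed.

Section hahn_banach.
Context {R : realType} {V : lmodType R}.
Variable S : set V.
Hypothesis S_lin : forall a u v, S u -> S v -> S (a *: u + v).

(** Everything is relative to a subspace [S], which will be the bounded functions inside the module
    of all functions. Positive homogeneity is an inequality, easier to check; [sublinearZ] recovers
    the equality by means of the inverse scalar. *)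
Definition sublinear_on (q : V -> R) :=
  (forall u v, S u -> S v -> q (u + v) <= q u + q v) /\
  (forall a u, 0 <= a -> S u -> q (a *: u) <= a * q u).

Let SD u v : S u -> S v -> S (u + v).
Proof. by move=> Su Sv; rewrite -[u]scale1r; exact: S_lin. Qed.

Let S0 u : S u -> S 0.
Proof. by move=> Su; rewrite -(addNr u) -scaleN1r; exact: S_lin. Qed.

Let SZ a u : S u -> S (a *: u).
Proof. by move=> Su; rewrite -[_ *: _]addr0; apply: S_lin => //; exact: S0 Su. Qed.

Let SN u : S u -> S (- u).
Proof. by move=> Su; rewrite -scaleN1r; exact: SZ. Qed.

Section sublinear_theory.
Variables (q : V -> R) (qS : sublinear_on q).

Let q0 u : S u -> q 0 = 0.
Proof.
case: qS => qD qZ Su; have S0u := S0 Su; apply/eqP; rewrite eq_le; apply/andP.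
split; first by have := qZ 0 0 (lexx _) S0u; rewrite scale0r mul0r.
by have := qD _ _ S0u S0u; rewrite addr0; lra.
Qed.

Lemma sublinear_oppr u : S u -> - q (- u) <= q u.
Proof.
move=> Su; have := qS.1 _ _ Su (SN Su); rewrite addrN (q0 Su); lra.
Qed.

Lemma sublinearZ a u : 0 <= a -> S u -> q (a *: u) = a * q u.
Proof.
rewrite le_eqVlt => /predU1P[<- Su|a0 Su]; first by rewrite scale0r mul0r (q0 Su).
apply/eqP; rewrite eq_le; apply/andP; split; first by apply: qS.2 => //; exact: ltW.
have ai : 0 <= a^-1 by rewrite invr_ge0 ltW.
have := qS.2 _ _ ai (SZ a Su).
by rewrite scalerA mulVf ?gt_eqF// scale1r ler_pdivlMl.
Qed.

(* A sublinear functional q that is minimal satisfies q <= flatten_along v on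
   all of S, and at t = 1 this reads q u + q v <= q (u + v): q is additive. *)
Definition flatten_along (v u : V) : R :=
  inf [set q (u + t *: v) - t * q v | t in [set t | 0 <= t]].

Let flat_neq0 v u :
  [set q (u + t *: v) - t * q v | t in [set t | 0 <= t]] !=set0.
Proof. by exists (q (u + 0 *: v) - 0 * q v); exists 0 => /=. Qed.

Lemma flatten_along_le v u t : S v -> S u -> 0 <= t ->
  flatten_along v u <= q (u + t *: v) - t * q v.
Proof.
move=> Sv Su t0; apply: ge_inf; last by exists t.
(* Subadditivity applied to [s *: v = (u + s *: v) - u] bounds the set from below. *)
exists (- q (- u)) => _ [s s0 <-].
have := qS.1 (u + s *: v) (- u) (SD Su (SZ s Sv)) (SN Su).
by rewrite addrAC addrN add0r sublinearZ//; lra.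
Qed.

Lemma flatten_along_ub v u : S v -> S u -> flatten_along v u <= q u.
Proof.
move=> Sv Su; have := flatten_along_le Sv Su (lexx 0).
by rewrite scale0r addr0 mul0r subr0.
Qed.

Lemma sublinear_flatten_along v : S v -> sublinear_on (flatten_along v).
Proof.
move=> Sv; split=> [u w Su Sw|a u].
  apply: le_infD => // _ _ [s s0 <-] [t t0 <-].
  apply: le_trans (flatten_along_le Sv (SD Su Sw) (addr_ge0 s0 t0)) _.
  have := qS.1 _ _ (SD Su (SZ s Sv)) (SD Sw (SZ t Sv)).
  by rewrite addrACA -scalerDl; lra.
rewrite le_eqVlt => /predU1P[<- Su|a0 Su].
  by rewrite scale0r mul0r -(q0 Su) flatten_along_ub//; exact: S0 Su.
rewrite -ler_pdivrMl//; apply: lb_le_inf => // _ [t t0 <-].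
rewrite ler_pdivrMl//.
apply: le_trans (flatten_along_le Sv (SZ a Su) (mulr_ge0 (ltW a0) t0)) _.
have := qS.2 _ _ (ltW a0) (SD Su (SZ t Sv)).
by rewrite scalerDr scalerA; lra.
Qed.

End sublinear_theory.

(** Zorn's lemma for the reversed pointwise order on [S]. A chain is bounded by its pointwise
    infimum: each member dominates [- p (- u)], so the infimum is finite, and the comparability of
    any two members keeps it subadditive. *)
Lemma minimal_sublinear (p : V -> R) : sublinear_on p ->
  exists q, [/\ sublinear_on q, forall u, S u -> q u <= p u
    & forall r, sublinear_on r -> (forall u, S u -> r u <= q u) ->
        forall u, S u -> q u <= r u].
Proof.
move=> pS.
pose T := {q : V -> R | sublinear_on q /\ forall u, S u -> q u <= p u}.
pose le_T (q r : T) := `[< forall u, S u -> sval r u <= sval q u >].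
have p_T : sublinear_on p /\ forall u, S u -> p u <= p u by [].
have [| |C Ctot|[q [qS qp]] qmin] := @ZL_preorder T (exist _ p p_T) le_T.
- by move=> t; apply/asboolP.
- move=> r s t /asboolP rs /asboolP st; apply/asboolP => u Su.
  exact: le_trans (st u Su) (rs u Su).
- have [->|/set0P[q0 Cq0]] := eqVneq C set0; first by exists (exist _ p p_T).
  pose r u := inf [set sval q u | q in C].
  have r_neq0 u : [set sval q u | q in C] !=set0 by exists (sval q0 u); exists q0.
  have r_le q u : C q -> S u -> r u <= sval q u.
    move=> Cq Su; apply: ge_inf; last by exists q.
    exists (- p (- u)) => _ [[s [/= sS sp]] _ <-].
    by apply: le_trans (sublinear_oppr sS Su); rewrite lerN2 sp//; exact: SN.
  have rS : sublinear_on r.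
    split=> [u v Su Sv|a u].
      apply: le_infD => // _ _ [s Cs <-] [t Ct <-].
      have [/asboolP st|/asboolP ts] := Ctot _ _ Cs Ct.
        apply: le_trans (r_le _ _ Ct (SD Su Sv)) _.
        by apply: le_trans ((svalP t).1.1 _ _ Su Sv) _; rewrite lerD2r st.
      apply: le_trans (r_le _ _ Cs (SD Su Sv)) _.
      by apply: le_trans ((svalP s).1.1 _ _ Su Sv) _; rewrite lerD2l ts.
    rewrite le_eqVlt => /predU1P[<- Su|a0 Su].
      apply: le_trans (r_le _ _ Cq0 (SZ 0 Su)) _.
      by rewrite (sublinearZ (svalP q0).1)// !mul0r.
    rewrite -ler_pdivrMl//; apply: lb_le_inf => // _ [t Ct <-].
    rewrite ler_pdivrMl//; apply: le_trans (r_le _ _ Ct (SZ a Su)) _.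
    by apply: (svalP t).1.2 => //; exact: ltW.
  have r_T : sublinear_on r /\ forall u, S u -> r u <= p u.
    split=> // u Su; apply: le_trans (r_le _ _ Cq0 Su) _.
    exact: (svalP q0).2.
  by exists (exist _ r r_T) => s Cs; apply/asboolP => u Su /=; exact: r_le.
exists q; split=> // r rS rq.
have r_T : sublinear_on r /\ forall u, S u -> r u <= p u.
  by split=> // u Su; apply: le_trans (rq _ Su) (qp _ Su).
by have /(_ _)/asboolP := qmin (exist _ r r_T); apply; apply/asboolP.
Qed.

(** A minimal functional is additive, hence linear. Flattening [p] along [x0] before minimizing
    forces the value at [x0]: at [- x0], the choice [t = 1] shows that the flattened functional is
    at most [p 0 - p x0 = - p x0]. *)
Lemma hahn_banach (p : V -> R) (x0 : V) : sublinear_on p -> S x0 ->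
  exists L : V -> R, [/\ forall a u v, S u -> S v -> L (a *: u + v) = a * L u + L v,
    forall u, S u -> L u <= p u & L x0 = p x0].
Proof.
move=> pS Sx0.
have [L [LS Lp Lmin]] := minimal_sublinear (sublinear_flatten_along pS Sx0).
have LD u v : S u -> S v -> L (u + v) = L u + L v.
  move=> Su Sv; apply/eqP; rewrite eq_le LS.1//=.
  have := Lmin _ (sublinear_flatten_along LS Sv)
    (fun w Sw => flatten_along_ub LS Sv Sw) u Su.
  move=> /le_trans /(_ (flatten_along_le LS Sv Su ler01)).
  by rewrite scale1r mul1r; lra.
have LN u : S u -> L (- u) = - L u.
  move=> Su; have := LD _ _ Su (SN Su); rewrite addrN.
  by have := sublinearZ LS (lexx 0) Su; rewrite scale0r mul0r; lra.
have LZ a u : S u -> L (a *: u) = a * L u.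
  move=> Su; have [a0|a0] := leP 0 a; first exact: sublinearZ.
  rewrite -[a]opprK scaleNr LN; last exact: SZ.
  by rewrite (sublinearZ LS)// ?oppr_ge0 1?ltW// !mulNr.
exists L; split=> [a u v Su Sv|u Su|].
- by rewrite LD ?LZ//; exact: SZ.
- exact: le_trans (Lp _ Su) (flatten_along_ub pS Sx0 Su).
apply/eqP; rewrite eq_le; apply/andP; split.
  exact: le_trans (Lp _ Sx0) (flatten_along_ub pS Sx0 Sx0).
have := le_trans (Lp _ (SN Sx0)) (flatten_along_le pS Sx0 (SN Sx0) ler01).
rewrite scale1r addNr mul1r LN//.
by have := sublinearZ pS (lexx 0) Sx0; rewrite scale0r mul0r; lra.
Qed.

End hahn_banach.

(** * From a tight finitely additive set function to a Borel probability *)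

Section radon_of_charge.
Context {R : realType} {T : ptopologicalType}.
Hypotheses (hT : hausdorff_space T) (rT : regular_space T).
Variable m : set T -> R.
Hypothesis m_ge0 : forall A, 0 <= m A.
Hypothesis mU : forall A B, A `&` B = set0 -> m (A `|` B) = m A + m B.

Let m0 : m set0 = 0.
Proof. by have := mU (setI0 set0); rewrite setU0; lra. Qed.

Let le_m A B : A `<=` B -> m A <= m B.
Proof.
move=> AB; rewrite -(setDUK AB) mU ?setDIK// lerDl; exact: m_ge0.
Qed.

Let leU_m A B : m (A `|` B) <= m A + m B.
Proof.
rewrite -(setDUK (@subsetUl _ A B)) setDUl setDv set0U.
by rewrite mU ?setDIK// lerD2l; apply: le_m; exact: subDsetl.
Qed.

Let leU_bigm n (F : nat -> set T) :
  m (\big[setU/set0]_(i < n) F i) <= \sum_(i < n) m (F i).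
Proof.
elim: n => [|n ih]; first by rewrite !big_ord0 m0.
by rewrite !big_ord_recr/= (le_trans (leU_m _ _))// lerD2r.
Qed.

Local Open Scope ereal_scope.

Definition inner_content (O : set T) : \bar R :=
  ereal_sup [set (m C)%:E | C in [set C | compact C /\ C `<=` O]].

Let inner_ge0 O : 0 <= inner_content O.
Proof.
apply: ereal_sup_ubound; exists set0; last by rewrite m0.
by split; [exact: compact0|exact: sub0set].
Qed.

Lemma inner_content_le O : inner_content O <= (m O)%:E.
Proof.
by apply: ge_ereal_sup => _ [C [_ CO] <-]; rewrite lee_fin le_m.
Qed.

Lemma le_inner_content C O : compact C -> C `<=` O -> (m C)%:E <= inner_content O.
Proof. by move=> cC CO; apply: ereal_sup_ubound; exists C. Qed.

Let inner_fin O : inner_content O \is a fin_num.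
Proof.
by rewrite ge0_fin_numE// (le_lt_trans (inner_content_le O))// ltry.
Qed.

(** Regularity covers the compact [C] by open sets whose closures each lie in a single [O n].
    Compactness leaves finitely many; grouping their closures by index cuts [C] into compact pieces
    [F i] inside [O i], and finite subadditivity of [m] concludes. *)
Let inner_bigcup (O : (set T)^nat) : (forall n, open (O n)) ->
  inner_content (\bigcup_n O n) <= \sum_(n <oo) inner_content (O n).
Proof.
move=> oO; apply: ge_ereal_sup => _ [C [cC CO] <-].
pose D := [set p : set T * nat | open p.1 /\ closure p.1 `<=` O p.2].
have : cover_compact C by rewrite -compact_cover.
move=> /(_ _ D fst)[p []//|x Cx|/= D' D'D CD'].
  have [n _ Onx] := CO x Cx.
  have [V Vx VO] := rT (open_nbhs_nbhs (conj (oO n) Onx)).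
  exists (interior V, n) => /=; last exact: Vx.
  split=> //=; first exact: open_interior.
  by apply: subset_trans VO; apply: closure_subset; exact: interior_subset.
pose F i := C `&` \bigcup_(p in [set p | p \in D' /\ p.2 = i]) closure p.1.
have cF i : compact (F i).
  apply: compact_closedI => //; apply: closed_bigcup.
    apply: (@sub_finite_set _ _ [set` D']) => //; by move=> p [].
  by move=> p _; exact: closed_closure.
have FO i : F i `<=` O i.
  move=> x [_ [p [pD' <-]]]; exact: (set_mem (D'D _ pD')).2.
pose n := (\max_(p <- D') p.2).+1.
have CF : C `<=` \big[setU/set0]_(i < n) F i.
  move=> x Cx; have [p pD' px] := CD' x Cx; rewrite -bigcup_mkord.
  exists p.2; first by rewrite /= ltnS; exact: (@leq_bigmax_seq _ _ _ snd).
  split=> //; exists p => //; exact: subset_closure.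
apply: (@le_trans _ _ (\sum_(0 <= i < n) inner_content (O i))).
  rewrite big_mkord; apply: (@le_trans _ _ (\sum_(i < n) (m (F i))%:E)).
    by rewrite sumEFin lee_fin (le_trans (le_m CF)).
  by apply: lee_sum => i _; exact: le_inner_content.
exact: nneseries_lim_ge.
Qed.

Definition outer_of_inner (A : set T) : \bar R :=
  ereal_inf [set inner_content O | O in [set O | open O /\ A `<=` O]].

Let outer_le A O : open O -> A `<=` O -> outer_of_inner A <= inner_content O.
Proof. by move=> oO AO; apply: ereal_inf_lbound; exists O. Qed.

Let outer_ge0 A : 0 <= outer_of_inner A.
Proof. by apply: le_ereal_inf_tmp => _ [G ? <-]. Qed.

Let outer_fin A : outer_of_inner A \is a fin_num.
Proof.
rewrite ge0_fin_numE//; apply: (le_lt_trans (outer_le openT (@subsetT _ A))).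
by rewrite -ge0_fin_numE.
Qed.

Let outer0 : outer_of_inner set0 = 0.
Proof.
apply/eqP; rewrite eq_le outer_ge0 andbT.
apply: (le_trans (outer_le open0 (@subset_refl _ _))).
by apply: (le_trans (inner_content_le _)); rewrite m0.
Qed.

Let le_outer : {homo outer_of_inner : A B / A `<=` B >-> A <= B}.
Proof.
move=> A B AB; apply: le_ereal_inf_tmp => _ [G [oO BO] <-].
by apply: outer_le => //; exact: subset_trans BO.
Qed.

Let outer_sigma_subadditive : sigma_subadditive outer_of_inner.
Proof.
move=> A; apply/lee_addgt0Pr => e e0.
apply: le_trans (epsilon_trick xpredT (fun=> outer_ge0 _) (ltW e0)).
have /choice[G PG] n : exists O, [/\ open O, A n `<=` O
    & inner_content O <= outer_of_inner (A n) + (e / (2 ^ n.+1)%:R)%:E].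
  have e'0 : (0 < e / (2 ^ n.+1)%:R)%R by rewrite divr_gt0// ltr0n expn_gt0.
  have [_ [G [oO AO] <-] /ltW ?] := lb_ereal_inf_adherent e'0 (outer_fin (A n)).
  by exists G.
apply: (@le_trans _ _ (inner_content (\bigcup_n G n))).
  apply: outer_le; first by apply: bigcup_open => n _; have [] := PG n.
  by apply: subset_bigcup => n _; have [] := PG n.
apply: le_trans (inner_bigcup _) _; first by move=> n; have [] := PG n.
by apply: lee_nneseries => // n _; have [] := PG n.
Qed.

HB.instance Definition _ := isOuterMeasure.Build R T outer_of_inner
  outer0 outer_ge0 le_outer outer_sigma_subadditive.

(** For [V] open around the test set, a compact [C] in the part of [V] inside [O] and then a compact
    [C'] in [V] minus [C] are disjoint, so [m] adds on them, and their union is a compact subset of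
    [V]. Hausdorffness makes [C] closed, so that [V] minus [C] is open. *)
Let outer_open_caratheodory O : open O -> outer_of_inner.-caratheodory O.
Proof.
move=> oO; apply: le_caratheodory_measurable => X.
apply: le_ereal_inf_tmp => _ [V [oV XV] <-].
rewrite -leeBrDr//; apply: (@le_trans _ _ (inner_content (V `&` O))).
  by apply: outer_le; [exact: openI|exact: setSI].
apply: ge_ereal_sup => _ [C [cC CVO] <-].
rewrite leeBrDr// addeC -leeBrDr//.
have oVC : open (V `\` C).
  by apply: openI => //; apply: closed_openC; exact: compact_closed.
apply: (@le_trans _ _ (inner_content (V `\` C))).
  by apply: outer_le => // x [Xx Ox]; split; [exact: XV|move=> /CVO[]].
apply: ge_ereal_sup => _ [C' [cC' C'VC] <-].
rewrite leeBrDr// -EFinD -mU.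
  apply: le_inner_content; first exact: compactU.
  by move=> x [/C'VC[]//|/CVO[]].
by apply/seteqP; split=> // x [/C'VC[]].
Qed.

Let measurable_caratheodory :
  @measurable _ (borel T) `<=` outer_of_inner.-caratheodory.
Proof.
apply: smallest_sub; last exact: outer_open_caratheodory.
exact: (@sigma_algebra_measurable _ (caratheodory_type outer_of_inner)).
Qed.

Definition borel_of_outer : set (borel T) -> \bar R := outer_of_inner.

Let borel_of_outer_sigma_additive : semi_sigma_additive borel_of_outer.
Proof.
move=> F mF tF mUF.
apply: (@caratheodory_measure_sigma_additive R T outer_of_inner) => //.
  by move=> i; exact: measurable_caratheodory.
exact: measurable_caratheodory.
Qed.

HB.instance Definition _ := isMeasure.Build _ (borel T) R borel_of_outer
  outer0 outer_ge0 borel_of_outer_sigma_additive.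

Hypothesis mT : m setT = 1%R.
Hypothesis m_tight :
  forall e : R, (0 < e)%R -> exists2 C, compact C & (1 - e <= m C)%R.

(** The content only sees compact sets and could lose mass; tightness excludes this. *)
Let borel_of_outer_setT : borel_of_outer setT = 1.
Proof.
apply/eqP; rewrite eq_le; apply/andP; split.
  apply: (le_trans (outer_le openT (@subset_refl _ _))).
  by apply: (le_trans (inner_content_le _)); rewrite mT.
apply: le_ereal_inf_tmp => _ [V [oV TV] <-]; apply/lee_addgt0Pr => e e0.
have [C cC Ce] := m_tight e0.
have CV : C `<=` V by exact: subset_trans TV.
apply: le_trans (leeD2r _ (le_inner_content cC CV)).
by rewrite -EFinD lee_fin -lerBlDr.
Qed.

HB.instance Definition _ := Measure_isProbability.Build _ (borel T) R
  borel_of_outer borel_of_outer_setT.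

Lemma tight_charge_dominates_probability :
  exists P : probability (borel T) R, forall O, open O -> P O <= (m O)%:E.
Proof.
exists borel_of_outer => O oO; apply: le_trans (inner_content_le O).
exact: (outer_le oO (@subset_refl _ _)).
Qed.

End radon_of_charge.

(** * Polish spaces *)

Lemma probability_setC_small d (T : measurableType d) (R : realType)
    (P : probability T R) (F : (set T)^nat) :
  (forall n, measurable (F n)) -> nondecreasing_seq F ->
  \bigcup_n F n = setT ->
  forall e : R, 0 < e -> exists n, (P (~` F n) <= e%:E)%E.
Proof.
move=> mF ndF FT e e0; apply: contrapT => /forallNP Pe.
suff : (e%:E <= 0)%E by rewrite lee_fin leNgt e0.
have <- : P (\bigcap_n ~` F n) = 0%E.
  by rewrite -setC_bigcup FT setCT measure0.
have mFC n : measurable (~` F n) by exact: measurableC.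
have niFC : nonincreasing_seq (fun n => ~` F n).
  by move=> i j ij; apply/subsetPset; apply: subsetC; exact/subsetPset/ndF.
have FC_cvg : P \o (fun n => ~` F n) @ \oo --> P (\bigcap_n ~` F n).
  apply: nonincreasing_cvg_mu => //; last exact: bigcapT_measurable.
  by apply: le_lt_trans (probability_le1 P (mFC 0)) _; exact: ltry.
apply: cvge_ge FC_cvg.
by apply: nearW => n /=; rewrite ltW// ltNge; exact/negP.
Qed.

Lemma ultra_bigsetU (T : Type) (F : set_system T) (A : (set T)^nat) n :
  UltraFilter F -> F (\big[setU/set0]_(i < n) A i) -> exists i, F (A i).
Proof.
move=> FU; elim: n => [|n ih].
  by rewrite big_ord0 => /filter_not_empty.
rewrite big_ord_recr/= => FAn.
have [FA|FA] := in_ultra_setVsetC (A n) FU; first by exists n.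
by apply: ih; apply: filterS (filterI FAn FA) => x [[]].
Qed.

Section polish_theory.
Context {R : realType} {T : ptopologicalType}.
Hypothesis polishT : polish R T.

Lemma polish_metric : exists d : T -> T -> R,
  [/\ forall x y, d x y = 0 -> x = y, forall x, d x x = 0,
      forall x y, 0 <= d x y, forall x y, d x y = d y x &
      forall x y z, d x z <= d x y + d y z] /\
  [/\ forall (x : T) (A : set T),
        nbhs x A <-> exists2 e : R, 0 < e & [set y | d x y < e] `<=` A
    & forall u : nat -> T,
        (forall e : R, 0 < e -> exists N, forall m n,
           (N <= m)%N -> (N <= n)%N -> d (u m) (u n) < e) ->
        exists l : T, u @ \oo --> l].
Proof.
have [_ [d [d0 dC dD dN dcomplete]]] := polishT.
exists d; split=> //; split=> //[x y /d0//|x|x y]; first exact/d0.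
by have := dD x y x; rewrite (dC y x) (proj2 (d0 x x) erefl); lra.
Qed.

Lemma polish_hausdorff : hausdorff_space T.
Proof.
have [d [[d0 dxx d_ge0 dC dD] [dN _]]] := polish_metric.
move=> p q pq; apply: contrapT => npq.
have dpq : 0 < d p q by rewrite lt_neqAle d_ge0 andbT; apply/eqP => /esym/d0.
have nb x : nbhs x [set y | d x y < d p q / 2].
  by apply/dN; exists (d p q / 2) => //; rewrite divr_gt0.
have [z [/= pz qz]] := pq _ _ (nb p) (nb q).
by have := dD p z q; rewrite (dC z q); lra.
Qed.

Lemma metric_closed_ball (d : T -> T -> R) (x : T) (r : R) :
  (forall x y z, d x z <= d x y + d y z) -> (forall x y, d x y = d y x) ->
  (forall (x : T) (A : set T),
     nbhs x A <-> exists2 e : R, 0 < e & [set y | d x y < e] `<=` A) ->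
  closed [set y | d x y <= r].
Proof.
move=> dD dC dN; rewrite -openC openE => y /= /negP; rewrite -ltNge => ry.
apply/dN; exists (d x y - r); first by rewrite subr_gt0.
move=> z /= yz; apply/negP; rewrite -ltNge.
by have := dD x z y; rewrite (dC z y); lra.
Qed.

Lemma polish_regular : regular_space T.
Proof.
have [d [[d0 dxx d_ge0 dC dD] [dN _]]] := polish_metric.
move=> a A /dN[e e0 eA]; exists [set y | d a y <= e / 2].
  apply/dN; exists (e / 2); first by rewrite divr_gt0.
  by move=> y /= /ltW.
rewrite -(closure_id _).1; last exact: metric_closed_ball.
by move=> y /= ay; apply: eA => /=; lra.
Qed.

Lemma polish_open_bigcup_closed (O : set T) : open O ->
  exists F : (set T)^nat, [/\ forall n, closed (F n), nondecreasing_seq F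
    & \bigcup_n F n = O].
Proof.
have [d [[d0 dxx d_ge0 dC dD] [dN _]]] := polish_metric.
(* The [n]-th set consists of the points at distance at least [1 / (n + 1)] from the complement of
   [O]. *)
move=> oO; exists (fun n => [set x | [set y | d x y < n.+1%:R^-1] `<=` O]); split.
- move=> n; rewrite -openC openE => x /= /existsNP[y /not_implyP[xy Oy]].
  apply/dN; exists (n.+1%:R^-1 - d x y); first by rewrite subr_gt0.
  move=> z /= xz zO; apply/Oy/zO => /=.
  by have := dD z x y; rewrite (dC z x); move: _^-1 xy xz => r; lra.
- move=> m n mn; apply/subsetPset => x /= xO y /= xy; apply: xO => /=.
  by apply: lt_le_trans xy _; rewrite lef_pV2 ?posrE// ler_nat.
apply/seteqP; split=> [x [n _]|x Ox].
  by apply => /=; rewrite dxx.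
have /dN[e e0 eO] := open_nbhs_nbhs (conj oO Ox).
have [n _ /(_ n (leqnn n)) ne] := near_infty_natSinv_lt (PosNum e0).
exists n => // y /= xy; apply: eO => /=; exact: lt_trans ne.
Qed.

Lemma polish_dense_seq (d : T -> T -> R) :
  (forall (x : T) (A : set T),
     nbhs x A <-> exists2 e : R, 0 < e & [set y | d x y < e] `<=` A) ->
  exists u : nat -> T, forall x (e : R), 0 < e -> exists i, d x (u i) < e.
Proof.
have [[D cD dD] _] := polishT; move=> dN.
have near_D x e : 0 < e -> exists2 y, D y & d x y < e.
  move=> e0; have : nbhs x [set y | d x y < e] by apply/dN; exists e.
  rewrite nbhsE => -[V [oV Vx] Ve].
  have [y [Vy Dy]] := dD V (ex_intro _ x Vx) oV.
  by exists y => //; exact: Ve.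
have [D0|[u]] := pfcard_geP cD.
  by have [y] := near_D point 1 ltr01; rewrite D0.
exists u => x e e0; have [y Dy xy] := near_D x e e0.
by have [i _ ui] := 'surj_u Dy; exists i; rewrite ui.
Qed.

(** For each [n], finitely many balls of radius [1 / (n + 1)] miss mass at most [e / 2 ^ (n + 1)].
    The intersection over [n] of these finite unions is closed and totally bounded, hence compact by
    completeness. *)
Lemma ulam_tight (P : probability (borel T) R) (e : R) : 0 < e ->
  exists C, [/\ compact C, closed C & (P (~` C) <= e%:E)%E].
Proof.
have [d [[d0 dxx d_ge0 dC dD] [dN d_complete]]] := polish_metric.
have [u u_dense] := polish_dense_seq dN.
move=> e0.
pose B n i := [set y | d (u i) y <= n.+1%:R^-1].
have clB n i : closed (B n i) by exact: metric_closed_ball.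
pose A n N := \big[setU/set0]_(i < N) B n i.
have clA n N : closed (A n N) by apply: closed_bigsetU => i _; exact: clB.
have mclosed (F : set (borel T)) : closed F -> measurable F.
  move=> clF; rewrite -(setCK F); apply: measurableC.
  by apply: sub_sigma_algebra; exact: closed_openC.
have ndA n : nondecreasing_seq (A n).
  by move=> i j ij; apply/subsetPset; exact: subset_bigsetU.
have AT n : \bigcup_N A n N = setT.
  rewrite -subTset => x _.
  have n0 : 0 < n.+1%:R^-1 :> R by rewrite invr_gt0.
  have [i xi] := u_dense x _ n0.
  exists i.+1 => //; rewrite /A big_ord_recr/=; right.
  by rewrite /B /= dC ltW.
have /choice[N PN] n : exists N, (P (~` A n N) <= (e / (2 ^ n.+1)%:R)%:E)%E.
  apply: (@probability_setC_small _ _ _ P (A n)) => //.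
    by move=> N; apply: mclosed; exact: (clA n N).
  by rewrite divr_gt0// ltr0n expn_gt0.
pose C := \bigcap_n A n (N n).
have clC : closed C by apply: closed_bigI => n _; exact: clA.
exists C; split=> //; last first.
  apply: (@le_trans _ _ (\sum_(n <oo) P (~` A n (N n)))%E).
    apply: measure_sigma_subadditive.
    - by move=> n; apply: measurableC; apply: mclosed; exact: (clA n (N n)).
    - by apply: measurableC; apply: mclosed; exact: clC.
    - by rewrite /C setC_bigcap.
  apply: le_trans (epsilon_trick0 xpredT (ltW e0)).
  by apply: lee_nneseries => // n _.
(* An ultrafilter containing [C] contains one ball for each radius. Any two of these balls meet, so
   their centres form a Cauchy sequence, whose limit is also the limit of the ultrafilter. *)
rewrite compact_ultra => F FU FC.
have /choice[k Fk] n : exists i, F (B n i).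
  apply: (@ultra_bigsetU _ F (B n) (N n)).
  by apply: filterS FC => x; exact.
have [l ul] : exists l : T, u (k n) @[n --> \oo] --> l.
  apply: (d_complete (u \o k)) => r r0.
  have r20 : 0 < r / 2 by rewrite divr_gt0.
  have [M _ Mr] := near_infty_natSinv_lt (PosNum r20).
  exists M => i j Mi Mj.
  have [x [/= ix jx]] := filter_ex (filterI (Fk i) (Fk j)).
  have := le_lt_trans ix (Mr i Mi); have := le_lt_trans jx (Mr j Mj) => /=.
  by have := dD (u (k i)) x (u (k j)); rewrite (dC x (u (k j))); lra.
have Fl : F --> l.
  move=> V /dN[r r0 rV].
  have r20 : 0 < r / 2 by rewrite divr_gt0.
  have [M _ Mr] := near_infty_natSinv_lt (PosNum r20).
  have [M' _ Mr'] : \forall n \near \oo, d l (u (k n)) < r / 2.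
    by apply: (ul [set y | d l y < r / 2]); apply/dN; exists (r / 2).
  have /= := Mr _ (leq_maxl M M'); have /= := Mr' _ (leq_maxr M M').
  set n := maxn M M' => ln nr.
  apply: filterS (Fk n) => x /le_lt_trans/(_ nr) nx; apply: rV => /=.
  by have := dD l (u (k n)) x; lra.
exists l; split=> //.
suff : closure C l by rewrite -(closure_id _).1.
move=> V Vl; apply/set0P/eqP => CV.
by apply: (@filter_not_empty _ F); rewrite -CV; apply: filterI => //; exact: Fl.
Qed.

(** Complementation turns the inequality on opens into the reverse one on closed sets, because both
    total masses are one. An open set is an increasing union of closed sets, so equality holds on
    opens, a generating pi-system. *)
Lemma polish_eq_probability (P Q : probability (borel T) R) :
  (forall O, open O -> (P O <= Q O)%E) -> forall A, measurable A -> P A = Q A.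
Proof.
move=> PQ A mA.
apply: (@measure_unique _ _ (borel T) (@open T) (fun=> setT) _ _ _ _ P Q) => //.
- by move=> B C; exact: openI.
- by move=> _; exact: openT.
- by rewrite -subTset => x _; exists 0%N.
- move=> O oO; apply/eqP; rewrite eq_le PQ//=.
  have [F [clF ndF FO]] := polish_open_bigcup_closed oO.
  have mF n : measurable (F n : set (borel T)).
    rewrite -(setCK (F n)); apply: measurableC.
    by apply: sub_sigma_algebra; exact: closed_openC.
  have mO : measurable (O : set (borel T)) by exact: sub_sigma_algebra.
  rewrite -FO.
  have cP := @nondecreasing_cvg_mu _ _ _ P F mF ltac:(by rewrite FO) ndF.
  have cQ := @nondecreasing_cvg_mu _ _ _ Q F mF ltac:(by rewrite FO) ndF.
  apply: (lee_cvg_to cQ cP); apply: nearW => n /=.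
  have := PQ _ (closed_openC (clF n)).
  by rewrite (probability_setC P)// (probability_setC Q)// leeD2lE// leeN2.
- by move=> _; apply: le_lt_trans (probability_le1 P _) (ltry 1); exact: measurableT.
Qed.

End polish_theory.

(** Regularity at [a] is a convergence to [a] of the filter generated by closures of neighbourhoods.
    In the product it can be checked one coordinate at a time, where the preimage of a closed
    neighbourhood in the factor is closed. *)
Lemma regular_product (I : eqType) (X : I -> topologicalType) :
  (forall i, regular_space (X i)) -> regular_space (prod_topology X).
Proof.
move=> rX a; apply/cvg_sup => [|i].
  apply: filter_from_filter; first by exists setT; exact: filterT.
  move=> V W aV aW; exists (V `&` W); first exact: filterI.
  exact: closureI.
move=> A /= [_ [[B oB <-] Ba] BA].
have [V Va VB] := rX i (a i) B (open_nbhs_nbhs (conj oB Ba)).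
exists (proj i @^-1` V); first exact: proj_continuous.
apply: subset_trans BA.
have clV : closed (proj i @^-1` closure V : set (prod_topology X)).
  apply: (iffLR (@continuous_closedP (prod_topology X) (X i) (@proj I X i))
    (@proj_continuous I X i)).
  exact: closed_closure.
have VclV : (proj i @^-1` V : set (prod_topology X)) `<=` proj i @^-1` closure V.
  by move=> x; exact: (@subset_closure _ V (x i)).
apply: (subset_trans (closure_subset VclV)).
rewrite -((closure_id _).1 clV).
by move=> x; exact: VB.
Qed.

(** * Dual families *)

Section bounded_measurable.
Context d {T : measurableType d} {R : realType} (P : probability T R).
Implicit Types (f g : T -> R) (B : R).

Lemma bounded_integrable f B : measurable_fun setT f ->
  (forall x, `|f x| <= B) -> P.-integrable setT (EFin \o f).
Proof.
move=> mf fB; apply: measurable_bounded_integrable => //.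
  by rewrite (@le_lt_trans _ _ 1%E)// ?ltry// probability_le1.
by exists B; split; [exact: num_real|move=> C BC x _; rewrite /= (le_trans (fB x))// ltW].
Qed.

Lemma Rintegral_probability_cst (r : R) : \int[P]_x r = r.
Proof.
rewrite Rintegral_cst; last exact: measurableT.
by rewrite (_ : fine _ = 1) ?mulr1// [X in fine X](probability_setT P).
Qed.

Lemma Rintegral_le_ub f (r : R) : P.-integrable setT (EFin \o f) ->
  (forall x, f x <= r) -> \int[P]_x f x <= r.
Proof.
move=> fi fr; rewrite -[leRHS]Rintegral_probability_cst.
apply: le_Rintegral => //.
apply: (@bounded_integrable _ `|r|) => //; exact: measurable_cst.
Qed.

Lemma Rintegral_ge_lb f (r : R) : P.-integrable setT (EFin \o f) ->
  (forall x, r <= f x) -> r <= \int[P]_x f x.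
Proof.
move=> fi fr; rewrite -[leLHS]Rintegral_probability_cst.
apply: le_Rintegral => //.
apply: (@bounded_integrable _ `|r|) => //; exact: measurable_cst.
Qed.

Lemma EFin_Rintegral f : P.-integrable setT (EFin \o f) ->
  (\int[P]_x f x)%:E = (\int[P]_x (f x)%:E)%E.
Proof. by move=> fi; rewrite /Rintegral fineK//; exact: integrable_fin_num. Qed.

End bounded_measurable.

Section dual_families.
Context {R : realType} {K : nat} {d : 'I_K -> measure_display}.
Context {T : forall k, measurableType (d k)}.
Variable P : forall k, probability (T k) R.
Implicit Types f g : forall k, T k -> R.

Definition bounded_family (B : R) f :=
  forall k, measurable_fun setT (f k) /\ forall x, `|f k x| <= B.

Definition dual_value f : R := \sum_(k < K) \int[P k]_x f k x.

Definition sub_cost (c : (forall k, T k) -> R) f :=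
  forall x : forall k, T k, \sum_(k < K) f k (x k) <= c x.

Lemma bounded_family_integrable B f k : bounded_family B f ->
  (P k).-integrable setT (EFin \o f k).
Proof. by move=> /(_ k)[mf fB]; exact: bounded_integrable fB. Qed.

Lemma dual_value_integrable f :
  (forall k, (P k).-integrable setT (EFin \o f k)) ->
  (dual_value f)%:E = (\sum_(k < K) \int[P k]_x (f k x)%:E)%E.
Proof.
by move=> fi; rewrite -sumEFin; apply: eq_bigr => k _; rewrite EFin_Rintegral.
Qed.

Lemma bounded_familyD B C f g : bounded_family B f -> bounded_family C g ->
  bounded_family (B + C) (fun k x => f k x + g k x).
Proof.
move=> fB gC k; split=> [|x].
  by apply: measurable_funD; [exact: (fB k).1|exact: (gC k).1].
by rewrite (le_trans (ler_normD _ _))// lerD//; [exact: (fB k).2|exact: (gC k).2].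
Qed.

Lemma bounded_familyZ B (a : R) f : bounded_family B f ->
  bounded_family (`|a| * B) (fun k x => a * f k x).
Proof.
move=> fB k; split=> [|x].
  by apply: measurable_funM; [exact: measurable_cst|exact: (fB k).1].
by rewrite normrM ler_wpM2l//; exact: (fB k).2.
Qed.

Lemma dual_valueD B C f g : bounded_family B f -> bounded_family C g ->
  dual_value (fun k x => f k x + g k x) = dual_value f + dual_value g.
Proof.
move=> fB gC; rewrite -big_split; apply: eq_bigr => k _ /=.
rewrite RintegralD//.
- exact: bounded_family_integrable fB.
- exact: bounded_family_integrable gC.
Qed.

Lemma dual_valueZ B (a : R) f : bounded_family B f ->
  dual_value (fun k x => a * f k x) = a * dual_value f.
Proof.
move=> fB; rewrite mulr_sumr; apply: eq_bigr => k _ /=.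
rewrite RintegralZl//.
exact: bounded_family_integrable fB.
Qed.

Lemma normr_dual_value B f : bounded_family B f -> `|dual_value f| <= B *+ K.
Proof.
move=> fB; apply: le_trans (ler_norm_sum _ _ _) _.
apply: (@le_trans _ _ (\sum_(k < K) B)); last by rewrite sumr_const card_ord.
apply: ler_sum => k _; have fi := bounded_family_integrable k fB.
rewrite ler_norml; apply/andP; split.
  by apply: Rintegral_ge_lb => // x; have := (fB k).2 x; rewrite ler_norml => /andP[].
by apply: Rintegral_le_ub => // x; have := (fB k).2 x; rewrite ler_norml => /andP[].
Qed.

(** The coordinates vary independently, so each can be chosen within [e / K] of its own supremum. *)
Lemma sum_sup_le f (M : R) : (0 < K)%N ->
  (forall k, has_ubound (range (f k))) ->
  (forall x : forall k, T k, \sum_(k < K) f k (x k) <= M) ->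
  \sum_(k < K) sup (range (f k)) <= M.
Proof.
move=> K0 fub fM; apply/ler_addgt0Pr => e e0.
have K0' : 0 < K%:R :> R by rewrite ltr0n.
have eK : 0 < e / K%:R by rewrite divr_gt0.
pose near_sup k x := sup (range (f k)) - e / K%:R < f k x.
have fsup k : has_sup (range (f k)) by split=> //; exists (f k point); exists point.
have ex k : exists x, near_sup k x.
  by have [_ [x _ <-] ?] := sup_adherent eK (fsup k); exists x.
pose x k := projT1 (cid (ex k)).
apply: (@le_trans _ _ (\sum_(k < K) (f k (x k) + e / K%:R))).
  by apply: ler_sum => k _; rewrite -lerBlDr; exact/ltW/(projT2 (cid (ex k))).
rewrite big_split/= sumr_const card_ord -[X in _ + X]mulr_natr divfK ?gt_eqF//.
by rewrite lerD2r.
Qed.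

(* If some component lies below sup f_k - 2M, truncating it there makes the
   whole sum at most M - 2M <= c; the remaining freedom of adding constants of
   zero total then gives a uniform bound. *)
Lemma dual_truncation (c : (forall k, T k) -> R) (M : R) f : (0 < K)%N ->
  (forall x, `|c x| <= M) ->
  (forall k, (P k).-integrable setT (EFin \o f k)) -> sub_cost c f ->
  exists g, [/\ bounded_family (3 * M) g, sub_cost c g
    & dual_value f <= dual_value g].
Proof.
move=> K0 cM fi fc.
have cM' x : - M <= c x <= M by rewrite -ler_norml.
have K0' : 0 < K%:R :> R by rewrite ltr0n.
have M0 : 0 <= M by apply: le_trans (cM (fun=> point)).
(* With the other coordinates frozen at [point], the constraint bounds [f k] above. *)
have fub k : has_ubound (range (f k)).
  exists (M - \sum_(l < K | l != k) f l point) => _ [x _ <-].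
  have := le_trans (fc (dfwith (fun=> point) k x)) (andP (cM' _)).2.
  rewrite (bigD1 k)//= dfwithin -lerBrDr => /le_trans; apply.
  rewrite lerD2l lerN2 le_eqVlt; apply/orP; left; apply/eqP.
  by apply: eq_bigr => l lk; rewrite dfwithout// eq_sym.
pose s k := sup (range (f k)).
have fs k x : f k x <= s k by apply: ub_le_sup => //; exists x.
pose S := \sum_(k < K) s k.
have SM : S <= M.
  by apply: sum_sup_le => // x; apply: le_trans (fc x) (andP (cM' x)).2.
(* The centred components [f k - s k] are nonpositive, and the constant [S'] is shared equally among
   them. It is [S] unless [S] falls below [- M]; then taking [- M] only raises the value, and the
   sum is still at most [- M], hence below [c]. *)
pose S' := Num.max S (- M).
have S'M : `|S'| <= M.
  by rewrite ler_norml /S' le_max lexx orbT ge_max SM; lra.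
pose g k x := Num.max (f k x - s k) (- (2 * M)) + S' / K%:R.
have mf k : measurable_fun setT (f k).
  by apply/measurable_EFinP; exact: measurable_int (fi k).
have gB : bounded_family (3 * M) g.
  move=> k; split=> [|x].
    apply: measurable_funD; last exact: measurable_cst.
    apply: measurable_maxr; last exact: measurable_cst.
    by apply: measurable_funB; [exact: mf|exact: measurable_cst].
  have SK : `|S' / K%:R| <= M.
    rewrite normrM normfV (ger0_norm (ltW K0')) ler_pdivrMr//.
    by rewrite (le_trans S'M)// ler_peMr// ler1n.
  rewrite /g (le_trans (ler_normD _ _))//.
  suff : `|Num.max (f k x - s k) (- (2 * M))| <= 2 * M by lra.
  rewrite ler_norml le_max lexx orbT ge_max /=; have := fs k x; lra.
exists g; split=> //.
  move=> x; rewrite /g big_split/= sumr_const card_ord.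
  rewrite -[X in _ + X]mulr_natr divfK ?gt_eqF//.
  have [/existsP[k fk]|/existsPn fx] := boolP [exists k, f k (x k) - s k < - (2 * M)].
    rewrite (bigD1 k)//= (max_idPr (ltW fk)).
    have : \sum_(l < K | l != k) Num.max (f l (x l) - s l) (- (2 * M)) <= 0.
      apply: sumr_le0 => l _; rewrite ge_max subr_le0 fs/=; lra.
    have := cM' x; move: S'M; rewrite ler_norml; lra.
  rewrite (eq_bigr (fun k => f k (x k) - s k)); last first.
    by move=> k _; apply/max_idPl; rewrite leNgt.
  rewrite sumrB -/S /S'; have [SM'|SM'] := leP S (- M).
    have : \sum_(k < K) f k (x k) <= S by apply: ler_sum => k _; exact: fs.
    have := cM' x; lra.
  by rewrite subrK; exact: fc.
apply: (@le_trans _ _ (\sum_(k < K) (\int[P k]_x f k x + (S' / K%:R - s k)))).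
  rewrite big_split/= lerDl sumrB sumr_const card_ord -[X in X - _]mulr_natr.
  by rewrite divfK ?gt_eqF// subr_ge0 /S' le_max lexx.
apply: ler_sum => k _.
have ci : (P k).-integrable setT (EFin \o cst (S' / K%:R - s k)).
  apply: (@bounded_integrable _ _ _ _ _ `|S' / K%:R - s k|) => //=.
rewrite -[X in _ + X](Rintegral_probability_cst (P k)) -RintegralD//.
apply: le_Rintegral => //.
- rewrite (_ : _ \o _ = ((EFin \o f k) \+ (EFin \o cst (S' / K%:R - s k)%R))%E)//.
  by apply: integrableD => //.
- exact: bounded_family_integrable gB.
move=> x _; rewrite /g; have : f k x - s k <= Num.max (f k x - s k) (- (2 * M)).
  by rewrite le_max lexx.
lra.
Qed.

End dual_families.

(** * A maximizing sequence with summable increments *)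

Section maximizing_sequence.
Context {R : realType} {K : nat} {d : 'I_K -> measure_display}.
Context {T : forall k, measurableType (d k)}.
Variable P : forall k, probability (T k) R.
Implicit Types f g : forall k, T k -> R.

Definition square_value f : R := dual_value P (fun k x => f k x ^+ 2).

Lemma bounded_family_sqr B f : bounded_family B f ->
  bounded_family (B ^+ 2) (fun k x => f k x ^+ 2).
Proof.
move=> fB k; split=> [|x]; first by apply: measurable_funX; exact: (fB k).1.
by rewrite normrX lerXn2r// ?nnegrE ?(le_trans _ ((fB k).2 x))//; exact: (fB k).2.
Qed.

Lemma bounded_family_sub B f g : bounded_family B f -> bounded_family B g ->
  bounded_family (2 * B) (fun k x => f k x - g k x).
Proof.
move=> fB gB k; split=> [|x].
  by apply: measurable_funB; [exact: (fB k).1|exact: (gB k).1].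
rewrite (le_trans (ler_normB _ _))//.
have := (fB k).2 x; have := (gB k).2 x; lra.
Qed.

Definition midpoint f g : forall k, T k -> R := fun k x => 2^-1 * f k x + 2^-1 * g k x.

Lemma bounded_midpoint B f g : bounded_family B f -> bounded_family B g ->
  bounded_family B (midpoint f g).
Proof.
move=> fB gB.
have := bounded_familyD (bounded_familyZ 2^-1 fB) (bounded_familyZ 2^-1 gB).
by rewrite ger0_norm ?invr_ge0// -mulrDl [2^-1 + 2^-1](_ : _ = 1) ?mul1r//; lra.
Qed.

Lemma dual_value_midpoint B f g : bounded_family B f -> bounded_family B g ->
  dual_value P (midpoint f g) = (dual_value P f + dual_value P g) / 2.
Proof.
move=> fB gB.
rewrite (dual_valueD P (bounded_familyZ 2^-1 fB) (bounded_familyZ 2^-1 gB)).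
by rewrite (dual_valueZ P _ fB) (dual_valueZ P _ gB) mulrDl ![2^-1 * _]mulrC.
Qed.

Lemma parallelogram B f g : bounded_family B f -> bounded_family B g ->
  square_value (fun k x => g k x - f k x) + 4 * square_value (midpoint f g) =
  2 * square_value f + 2 * square_value g.
Proof.
move=> fB gB.
have sB := bounded_family_sqr (bounded_family_sub gB fB).
have mB := bounded_family_sqr (bounded_midpoint fB gB).
have fB2 := bounded_family_sqr fB.
have gB2 := bounded_family_sqr gB.
rewrite -(dual_valueZ P _ mB) -(dual_valueZ P _ fB2) -(dual_valueZ P _ gB2).
rewrite -(dual_valueD P sB (bounded_familyZ 4 mB)).
rewrite -(dual_valueD P (bounded_familyZ 2 fB2) (bounded_familyZ 2 gB2)).
congr dual_value; apply: functional_extensionality_dep => k.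
by apply/funext => x; rewrite /midpoint; field.
Qed.

(* |h| <= t + h^2 / t turns the L^2 bound into an L^1 bound without a square root. *)
Lemma integral_norm_le_square_value B f (t : R) k : bounded_family B f -> 0 < t ->
  \int[P k]_x `|f k x| <= t + t^-1 * square_value f.
Proof.
move=> fB t0; have f2B := bounded_family_sqr fB.
have f2i := bounded_family_integrable P k f2B.
have cB : bounded_family t (fun k (x : T k) => t).
  by move=> l; split=> // x; rewrite gtr0_norm.
have rB := bounded_familyD cB (bounded_familyZ t^-1 f2B).
apply: (@le_trans _ _ (\int[P k]_x (t + t^-1 * f k x ^+ 2))).
  apply: le_Rintegral => //.
  - apply: (@bounded_integrable _ _ _ _ _ B) => [|x].
      by apply: measurableT_comp => //; exact: (fB k).1.
    by rewrite normr_id; exact: (fB k).2.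
  - exact: (bounded_family_integrable P k rB).
  move=> x _; rewrite -(ler_pM2l t0) mulrDr mulrA mulfV ?gt_eqF// mul1r.
  rewrite -(real_normK (num_real (f k x))).
  by set a := `|_|; have := sqr_ge0 (t - a); have := sqr_ge0 a; nra.
rewrite RintegralD//; last 2 first.
- exact: (bounded_family_integrable P k cB).
- exact: (bounded_family_integrable P k (bounded_familyZ t^-1 f2B)).
rewrite Rintegral_probability_cst RintegralZl// lerD2l ler_wpM2l ?invr_ge0 ?(ltW t0)//.
rewrite /square_value /dual_value (bigD1 k)//= lerDl.
by apply: sumr_ge0 => l _; apply: Rintegral_ge0 => x _; exact: sqr_ge0.
Qed.

Variables (c : (forall k, T k) -> R) (B : R).

Definition bounded_sub_cost : set (forall k, T k -> R) :=
  [set f | bounded_family B f /\ sub_cost c f].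

Definition dual_sup : R := sup [set dual_value P f | f in bounded_sub_cost].

Hypothesis nonempty : bounded_sub_cost !=set0.

Lemma bounded_sub_cost_has_sup : has_sup [set dual_value P f | f in bounded_sub_cost].
Proof.
split; first by have [f ?] := nonempty; exists (dual_value P f), f.
exists (B *+ K) => _ [f [fB _] <-].
exact: le_trans (ler_norm _) (normr_dual_value P fB).
Qed.

Lemma dual_value_le_sup f : bounded_sub_cost f -> dual_value P f <= dual_sup.
Proof.
by move=> Af; apply: (ub_le_sup bounded_sub_cost_has_sup.2); exists f.
Qed.

Lemma midpoint_sub_cost f g :
  bounded_sub_cost f -> bounded_sub_cost g -> bounded_sub_cost (midpoint f g).
Proof.
move=> [fB fc] [gB gc]; split; first exact: bounded_midpoint.
by move=> x; rewrite /midpoint big_split/= -!mulr_sumr; have := fc x; have := gc x; lra.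
Qed.

Let slice N : set (forall k, T k -> R) :=
  [set f | bounded_sub_cost f /\ dual_sup - N.+1%:R^-1 <= dual_value P f].

Let slice_le M N : (M <= N)%N -> slice N `<=` slice M.
Proof.
move=> MN f [Af Df]; split=> //; apply: le_trans Df.
by rewrite lerD2l lerN2 lef_pV2 ?posrE// ler_nat.
Qed.

(** Slices shrink with [N], so [q] is nondecreasing, and from some index on it stays within any
    tolerance of its supremum. *)
Let q N := inf [set square_value f | f in slice N].

Let slice_has_inf N : has_inf [set square_value f | f in slice N].
Proof.
split.
  have [|_ [f Af <-] Df] := sup_adherent (_ : 0 < N.+1%:R^-1) bounded_sub_cost_has_sup.
    by rewrite invr_gt0.
  by exists (square_value f), f => //; split=> //; exact: ltW.
exists (- (B ^+ 2 *+ K)) => _ [f [[fB _] _] <-].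
have := normr_dual_value P (bounded_family_sqr fB).
by rewrite ler_norml => /andP[].
Qed.

Let q_le N f : slice N f -> q N <= square_value f.
Proof. by move=> sf; apply: (ge_inf (slice_has_inf N).2); exists f. Qed.

Let q_has_sup : has_sup (range q).
Proof.
split; first by exists (q 0), 0%N.
exists (B ^+ 2 *+ K) => _ [N _ <-].
have [_ [f sf _]] := (slice_has_inf N).1; apply: le_trans (q_le sf) _.
exact: le_trans (ler_norm _) (normr_dual_value P (bounded_family_sqr sf.1.1)).
Qed.

(* By the parallelogram identity, two elements of a slice of nearly minimal
   square value are close in L^2. *)
Lemma maximizing_sequence_cauchy :
  exists f : nat -> forall k, T k -> R,
    [/\ forall n, bounded_sub_cost (f n),
        forall n, dual_sup - n.+1%:R^-1 <= dual_value P (f n)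
      & forall n k, \int[P k]_x `|f n.+1 k x - f n k x| <= 9 * 2 ^- n].
Proof.
(* The tolerance on square values is the square of [t n]: a square value of at most [8 * e n] for
   the increment bounds its L^1 norm by [t n + 8 * t n], whence the constant 9. *)
pose t n : R := 2 ^- n; pose e n := t n ^+ 2.
have t0 n : 0 < t n by rewrite invr_gt0 exprn_gt0.
have e0 n : 0 < e n by rewrite exprn_gt0.
have /choice[N NP] n : exists N, sup (range q) - e n < q N.
  by have [_ [N _ <-] ?] := sup_adherent (e0 n) q_has_sup; exists N.
(* [M] is nondecreasing and dominates both [n] and [N n], so consecutive terms of the sequence share
   the slice [M n]. *)
pose M n := (n + \sum_(m < n.+1) N m)%N.
have MS n : (M n <= M n.+1)%N.
  by rewrite /M [X in (_ <= _ + X)%N]big_ord_recr/= leq_add// leq_addr.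
have NM n : (N n <= M n)%N.
  by rewrite /M big_ord_recr/= addnA leq_addl.
have /choice[f fP] n : exists f, slice (M n) f /\ square_value f < sup (range q) + e n.
  have [_ [f sf <-] fe] := inf_adherent (e0 n) (slice_has_inf (M n)).
  exists f; split=> //; apply: lt_le_trans fe _; rewrite lerD2r.
  by apply: (ub_le_sup q_has_sup.2); exists (M n).
exists f; split=> [n|n|n k]; first exact: (fP n).1.1.
  by apply: le_trans (fP n).1.2; rewrite lerD2l lerN2 lef_pV2 ?posrE// ler_nat leq_addr.
have [[Af Df] Qf] := fP n; have sf' := slice_le (MS n) (fP n.+1).1.
have Qf' := (fP n.+1).2; have [Af' Df'] := sf'.
(* The midpoint has square value above [sup (range q) - e n], the two endpoints below
   [sup (range q) + e n]; the parallelogram identity leaves at most [8 * e n] for the difference. *)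
have sm : slice (M n) (midpoint (f n) (f n.+1)).
  split; first exact: midpoint_sub_cost.
  by rewrite (dual_value_midpoint Af.1 Af'.1); move: Df Df'; set r := _^-1; lra.
have mq := lt_le_trans (NP n) (q_le (slice_le (NM n) sm)).
have eS : e n.+1 <= e n.
  rewrite /e lerXn2r ?nnegrE ?(ltW (t0 _))// /t lef_pV2 ?posrE ?exprn_gt0//.
  by rewrite ler_weXn2l// ler1n.
have := parallelogram Af.1 Af'.1.
have := integral_norm_le_square_value k (bounded_family_sub Af'.1 Af.1) (t0 n).
set I := Rintegral _ _ _; set Qd := square_value _ => Id par.
have Qd8 : Qd <= 8 * e n by lra.
apply: (le_trans Id).
have : (t n)^-1 * Qd <= 8 * t n by rewrite ler_pdivrMl// /e in Qd8 *; lra.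
by rewrite -/(t n); lra.
Qed.

End maximizing_sequence.

(** * Lower limits *)

Section lower_limit.
Context {R : realType}.
Variables (u : nat -> R) (B : R).
Hypothesis uB : forall n, `|u n| <= B.

(** The liminf of [u], kept real-valued; boundedness of [u] makes the supremum meaningful. *)
Definition lower_limit : R :=
  sup [set y | exists n, forall j, (n <= j)%N -> y <= u j].

Let lower_has_sup : has_sup [set y | exists n, forall j, (n <= j)%N -> y <= u j].
Proof.
split; first by exists (- B), 0%N => j _; have := uB j; rewrite ler_norml => /andP[].
exists B => y [n /(_ n (leqnn n)) yu]; apply: le_trans yu _.
exact: le_trans (ler_norm _) (uB n).
Qed.

Lemma le_lower_limit y n : (forall j, (n <= j)%N -> y <= u j) -> y <= lower_limit.
Proof. by move=> yu; apply: (ub_le_sup lower_has_sup.2); exists n. Qed.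

Lemma lower_limit_adherent e : 0 < e ->
  exists n, forall j, (n <= j)%N -> lower_limit - e <= u j.
Proof.
move=> e0; have [y [n yu] ye] := sup_adherent e0 lower_has_sup.
by exists n => j nj; apply: le_trans (yu j nj); exact: ltW.
Qed.

Lemma normr_lower_limit : `|lower_limit| <= B.
Proof.
rewrite ler_norml; apply/andP; split.
  by apply: (@le_lower_limit _ 0%N) => j _; have := uB j; rewrite ler_norml => /andP[].
apply: ge_sup; first exact: lower_has_sup.1.
move=> y [n /(_ n (leqnn n)) yu]; apply: le_trans yu _.
exact: le_trans (ler_norm _) (uB n).
Qed.

End lower_limit.

Lemma telescope_le (R : realType) (u : nat -> R) n j :
  u n - u (n + j)%N <= \sum_(i < j) `|u (n + i).+1 - u (n + i)%N|.
Proof.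
elim: j => [|j ih]; first by rewrite addn0 subrr big_ord0.
rewrite big_ord_recr/= addnS; set x := u (n + j)%N; set y := u (n + j).+1.
have : x - y <= `|y - x| by rewrite distrC ler_norm.
by rewrite -/x in ih; lra.
Qed.

(** By telescoping, [f n] exceeds the lower limit by at most the sum of the later increments, whose
    integral is at most [e]. The conclusion concerns a measurable [g] above the lower limit, the
    form in which c-transforms will enter. *)
Lemma Rintegral_le_lower_limit d (T : measurableType d) (R : realType)
    (P : probability T R) (f : nat -> T -> R) (g : T -> R) (B C e : R) n :
  (forall m, measurable_fun setT (f m)) -> (forall m x, `|f m x| <= B) ->
  measurable_fun setT g -> (forall x, `|g x| <= C) -> 0 <= e ->
  (forall i, \int[P]_x `|f (n + i).+1 x - f (n + i)%N x| <= e / (2 ^ i.+1)%:R) ->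
  (forall x, lower_limit (f ^~ x) <= g x) ->
  \int[P]_x f n x <= \int[P]_x g x + e.
Proof.
move=> mf fB mg gC e0 fe fg.
pose D i x : R := `|f (n + i).+1 x - f (n + i)%N x|.
have mD i : measurable_fun setT (D i).
  by apply: measurableT_comp => //; exact: measurable_funB.
have DB i x : `|D i x| <= 2 * B.
  rewrite normr_id (le_trans (ler_normB _ _))//.
  by have := fB (n + i).+1 x; have := fB (n + i)%N x; lra.
have D0 i x : (0 <= (D i x)%:E)%E by rewrite lee_fin normr_ge0.
pose S x : \bar R := (\sum_(i <oo) (D i x)%:E)%E.
have fgS x : ((f n x + B)%:E <= (g x + B)%:E + S x)%E.
  (* The increments may fail to be summable at some points; there the bound is trivial. *)
  have [Sx|] := eqVneq (S x) +oo%E; first by rewrite Sx addey ?leey.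
  have S0 : (0 <= S x)%E by apply: nneseries_ge0 => i _ _; exact: D0.
  move: S0; case SE : (S x) => [s| |]// _ _.
  rewrite -EFinD lee_fin.
  suff : f n x - s <= lower_limit (f ^~ x) by have := fg x; lra.
  apply: (le_lower_limit (fun m => fB m x) (n := n)) => j nj.
  rewrite -(subnKC nj); have := telescope_le (f ^~ x) n (j - n).
  suff : \sum_(i < j - n) `|f (n + i).+1 x - f (n + i)%N x| <= s by lra.
  rewrite -lee_fin -SE -sumEFin -(big_mkord xpredT (fun i => (D i x)%:E)).
  by apply: nneseries_lim_ge => i _ _; exact: D0.
have mE (h : T -> R) : measurable_fun setT h -> measurable_fun setT (EFin \o h).
  by move=> mh; exact/measurable_EFinP.
have mB (h : T -> R) : measurable_fun setT h -> measurable_fun setT (fun x => h x + B).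
  by move=> mh; apply: measurable_funD.
have mS : measurable_fun setT S.
  by apply: (@ge0_emeasurable_sum _ _ _ _ _ predT) => [i x _ _|i _]; [exact: D0|exact: mE].
have fB0 x : 0 <= f n x + B.
  by have := fB n x; rewrite ler_norml; lra.
have gB0 x : 0 <= g x + B.
  have := normr_lower_limit (fun m => fB m x); have := fg x.
  by rewrite ler_norml; lra.
have fi : P.-integrable setT (EFin \o f n) by exact: bounded_integrable (fB n).
have gi : P.-integrable setT (EFin \o g) by exact: bounded_integrable gC.
have Bi : P.-integrable setT (EFin \o cst B).
  by apply: (@bounded_integrable _ _ _ _ _ `|B|).
have EB h : P.-integrable setT (EFin \o h) ->
    (\int[P]_x (h x + B)%:E)%E = (\int[P]_x h x + B)%:E.
  move=> hi; rewrite -EFin_Rintegral.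
    by rewrite RintegralD// Rintegral_probability_cst.
  rewrite (_ : _ \o _ = ((EFin \o h) \+ (EFin \o cst B))%E)//.
  exact: integrableD.
(* Adding [B] makes both functions nonnegative, since [g] is above a lower limit that is at least
   [- B]; the integral of the sum with the extended-valued [S] can then be split. *)
suff : ((\int[P]_x f n x + B)%:E <= (\int[P]_x g x + B)%:E + e%:E)%E.
  by rewrite -EFinD lee_fin; lra.
rewrite -EB// -EB//.
apply: (@le_trans _ _ (\int[P]_x ((g x + B)%:E + S x))%E).
  apply: ge0_le_integral => //.
  - by move=> x _; rewrite lee_fin.
  - exact: mE (mB _ (mf n)).
  - by apply: emeasurable_funD => //; exact: mE (mB _ mg).
rewrite ge0_integralD//; last 3 first.
- by move=> x _; rewrite lee_fin.
- exact: mE (mB _ mg).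
- by move=> x _; apply: nneseries_ge0 => i _ _; exact: D0.
rewrite leeD2l// (integral_nneseries P measurableT (fun i => mE _ (mD i))
  (fun i x _ => D0 i x)).
apply: le_trans (epsilon_trick0 xpredT e0); apply: lee_nneseries => i *.
  by apply: integral_ge0 => x _; exact: D0.
rewrite -EFin_Rintegral ?lee_fin; first exact: fe.
exact: bounded_integrable (DB i).
Qed.

(** * Limit of the maximizing sequence *)

Section dual_limit.
Context {R : realType} {K : nat} {d : 'I_K -> measure_display}.
Context {T : forall k, measurableType (d k)}.
Variable P : forall k, probability (T k) R.
Variables (c : (forall k, T k) -> R) (B : R).

Lemma sub_cost_lower_limit (f : nat -> forall k, T k -> R) :
  (forall n k x, `|f n k x| <= B) -> (forall n, sub_cost c (f n)) ->
  sub_cost c (fun k x => lower_limit (fun n => f n k x)).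
Proof.
move=> fB fc x; apply/ler_addgt0Pr => e e0.
have eK : 0 < e / K.+1%:R by rewrite divr_gt0// ltr0n.
have /choice[N NP] k := lower_limit_adherent (fun n => fB n k (x k)) eK.
pose j := (\sum_(k < K) N k)%N.
have Nj k : (N k <= j)%N by rewrite /j (bigD1 k)//= leq_addr.
apply: (@le_trans _ _ (\sum_(k < K) (f j k (x k) + e / K.+1%:R))).
  by apply: ler_sum => k _; rewrite -lerBlDr; exact: NP.
rewrite big_split/= sumr_const card_ord lerD ?fc//.
rewrite -[leLHS]mulr_natr mulrAC ler_pdivrMr ?ltr0n//.
by rewrite ler_pM2l// ler_nat.
Qed.

Hypothesis nonempty : @bounded_sub_cost _ _ _ T c B !=set0.

(** Optimality is expressed through the bounded measurable families above [phi]; the c-conjugate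
    family will be one of them. *)
Lemma dual_limit : exists phi : forall k, T k -> R,
  [/\ forall k x, `|phi k x| <= B, sub_cost c phi
    & forall (C : R) g, bounded_family C g -> (forall k x, phi k x <= g k x) ->
        dual_sup P c B <= dual_value P g].
Proof.
have [f [Af Df fe]] := maximizing_sequence_cauchy P nonempty.
have fB n k x : `|f n k x| <= B by exact: ((Af n).1 k).2.
exists (fun k x => lower_limit (fun n => f n k x)); split.
- by move=> k x; exact: normr_lower_limit.
- by apply: sub_cost_lower_limit => // n; exact: (Af n).2.
move=> C g gC phig.
(* The increment at [n + i] is at most [9 * 2 ^- (n + i)], which is [18 * 2 ^- n] divided by
   [2 ^ (i + 1)]. *)
have fg n k : \int[P k]_x f n k x <= \int[P k]_x g k x + 18 * 2 ^- n.
  apply: (@Rintegral_le_lower_limit _ _ _ (P k) (fun m => f m k) (g k) B C _ n) => //.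
  - by move=> m; exact: ((Af m).1 k).1.
  - exact: (gC k).1.
  - exact: (gC k).2.
  - move=> i; apply: le_trans (fe _ _) _.
    rewrite natrX exprD exprS !invfM le_eqVlt; apply/orP; left; apply/eqP.
    by move: (2 ^+ n)^-1 (2 ^+ i)^-1 => a b; field.
have fg' n : dual_value P (f n) <= dual_value P g + 18 * 2 ^- n *+ K.
  apply: le_trans (ler_sum _ (fun k _ => fg n k)) _.
  by rewrite big_split/= sumr_const card_ord.
apply/ler_addgt0Pr => e e0.
have e'0 : 0 < e / (18 *+ K + 1) by rewrite divr_gt0// ltr_wpDl// mulrn_wge0.
have [n _ /(_ n (leqnn n)) ne] := near_infty_natSinv_lt (PosNum e'0).
have := Df n; have := fg' n.
have n2 : 2 ^- n <= n.+1%:R^-1 :> R.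
  by rewrite lef_pV2 ?posrE ?exprn_gt0// -natrX ler_nat ltn_expl.
move: ne => /=; rewrite ltr_pdivlMr; last by rewrite ltr_wpDl// mulrn_wge0.
move: n2; move: (n.+1%:R^-1) => r; move: (2 ^- n) => s sr.
rewrite -(mulr_natr 18 K) -(mulr_natr (18 * s) K) => rK h1 h2.
have h3 : 18 * s * K%:R <= 18 * r * K%:R by rewrite ler_wpM2r// ler_pM2l.
by move: rK h1 h2 h3; move: K%:R => a; lra.
Qed.

End dual_limit.

(** * c-transforms *)

Lemma open_sublevel_measurable (R : realType) (T : ptopologicalType) (f : T -> R) :
  (forall t, open [set x | f x < t]) -> measurable_fun [set: borel T] f.
Proof.
move=> of_; apply: (measurability _ (RGenInftyO.measurableE R)).
move=> _ [_ [t ->] <-]; rewrite setTI; apply: sub_sigma_algebra.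
by rewrite (_ : _ @^-1` _ = [set x | f x < t]).
Qed.

Section c_transform.
Context {R : realType} {K : nat} {X : 'I_K -> ptopologicalType}.
Variable c : prod_topology X -> R.
Implicit Type h : forall l, X l -> R.

Definition c_transform (k : 'I_K) h (x : X k) : R :=
  inf [set c y - \sum_(l < K | l != k) h l (y l)
      | y in [set y : prod_topology X | y k = x]].

Variable h : forall l, X l -> R.
Arguments h : clear implicits.
Hypothesis h_sub : forall x : prod_topology X, \sum_(l < K) h l (x l) <= c x.

Let h_lb k x : lbound [set c y - \sum_(l < K | l != k) h l (y l)
  | y in [set y : prod_topology X | y k = x]] (h k x).
Proof.
move=> _ [y /= <- <-]; have := h_sub y; rewrite (bigD1 k)//=.
by rewrite lerBrDr.
Qed.

Let c_transform_neq0 k x : [set c y - \sum_(l < K | l != k) h l (y l)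
  | y in [set y : prod_topology X | y k = x]] !=set0.
Proof.
pose y : prod_topology X := dfwith (fun=> point) k x.
by exists (c y - \sum_(l < K | l != k) h l (y l)), y; rewrite //= /y dfwithin.
Qed.

Lemma c_transform_ge k (x : X k) : h k x <= c_transform h x.
Proof. by apply: lb_le_inf; [exact: c_transform_neq0|exact: h_lb]. Qed.

Lemma c_transform_le k (y : prod_topology X) :
  c_transform h (y k) <= c y - \sum_(l < K | l != k) h l (y l).
Proof. by apply: ge_inf; [exists (h k (y k)); exact: h_lb|exists y]. Qed.

(** The constraint makes [h k x] a lower bound, so the real infimum agrees with the extended one
    required by [c_conj]. *)
Lemma c_transform_conj k : c_conj c (c_transform (k := k) h).
Proof.
exists h => x; rewrite /c_transform -ereal_inf_EFin.
- by rewrite image_comp.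
- by exists (h k x); exact: h_lb.
- exact: c_transform_neq0.
Qed.

(** Upper semicontinuity, as for any infimum of continuous functions: a [y] that brings the infimum
    below [t] at [x] still does so when only its [k]-th coordinate moves slightly. *)
Lemma open_c_transform_lt k t : continuous c ->
  open [set x : X k | c_transform h x < t].
Proof.
move=> cc; rewrite openE => x /= /inf_lt[|_ [y /= yx <-] ct].
  exact: c_transform_neq0.
have dfE : dfwith y k x = y.
  by apply: functional_extensionality_dep => l; case: dfwithP => //; rewrite yx.
have cdf : {for x, continuous (fun z : X k => c (dfwith y k z))}.
  apply: (@continuous_comp _ (prod_topology X) _ (dfwith y k) c).
    exact: (@dfwith_continuous _ X y k x).
  exact: cc.
have := @cvgr_lt _ _ _ _ _ _ cdf (t + \sum_(l < K | l != k) h l (y l)).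
rewrite dfE -ltrBlDr => /(_ _ ct); apply: filterS => z /=.
rewrite -ltrBlDr; apply: le_lt_trans.
have := c_transform_le k (dfwith y k z).
rewrite dfwithin => /le_trans; apply; rewrite lerD2l lerN2 le_eqVlt.
apply/orP; left; apply/eqP; apply: eq_bigr => l lk.
by rewrite dfwithout// eq_sym.
Qed.

End c_transform.

Section c_conjugation.
Context {R : realType} {K : nat} {X : 'I_K -> ptopologicalType}.
Variables (c : prod_topology X -> R) (M : R).
Hypotheses (c_cont : continuous c) (cM : forall x, `|c x| <= M).

Let cost_family := @sub_cost R K _ (fun k => borel (X k)) c.

(** Coordinates are replaced one at a time by their c-transforms. [c_conj] asks only for some family
    [h], so a coordinate already treated stays conjugate when the others change later. *)
Lemma c_conjugation (B : R) (phi : forall k, X k -> R) :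
  (forall k x, `|phi k x| <= B) -> cost_family phi ->
  exists g : forall k, X k -> R,
    [/\ @bounded_family R K _ (fun k => borel (X k)) (M + B *+ K) g,
        cost_family g, forall k x, phi k x <= g k x & forall k, c_conj c (g k)].
Proof.
move=> phiB phic.
pose good (k : 'I_K) (f : X k -> R) :=
  [/\ measurable_fun [set: borel (X k)] f, forall x, `|f x| <= M + B *+ K & c_conj c f].
suff /(_ K) [g [gc phig gK]] : forall n, exists g : forall k, X k -> R,
    [/\ cost_family g, forall k x, phi k x <= g k x
      & forall k : 'I_K, (k < n)%N -> good k (g k)].
  exists g; split=> // k; last by have [] := gK k (ltn_ord k).
  by have [] := gK k (ltn_ord k).
elim=> [|n [h [hc phih hn]]]; first by exists phi.
have [nK|Kn] := ltnP n K; last first.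
  by exists h; split=> // k _; apply: hn; exact: leq_trans (ltn_ord k) Kn.
pose k := Ordinal nK.
(* All iterates stay above [phi] and share its lower bound [- B]. The upper bound [M + B *+ K] of a
   transform rests on this alone, so it does not grow along the induction. *)
have hge l x : - B <= h l x.
  by apply: le_trans (phih l x); have := phiB l x; rewrite ler_norml => /andP[].
pose Tk := c_transform c (k := k) h.
pose g := dfwith (T := fun l => X l -> R) h k Tk.
have gk : g k = Tk by rewrite /g dfwithin.
have gl l : k != l -> g l = h l by move=> kl; rewrite /g dfwithout.
exists g; split.
- move=> x; rewrite (bigD1 k)//= gk.
  have := c_transform_le hc k x; rewrite lerBrDr; apply: le_trans.
  rewrite lerD2l le_eqVlt; apply/orP; left; apply/eqP; apply: eq_bigr => l lk.
  by rewrite gl// eq_sym.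
- move=> l x; have [kl|kl] := eqVneq k l; last by rewrite gl.
  by case: l / kl x => x; rewrite gk; apply: le_trans (c_transform_ge hc x).
move=> l; rewrite ltnS leq_eqVlt => /orP[/eqP ln|ln]; last first.
  by rewrite gl; [exact: hn|rewrite -val_eqE/= gtn_eqF].
have kl : k = l by exact: val_inj.
case: l / kl {ln}; rewrite gk; split.
- by apply: open_sublevel_measurable => t; exact: open_c_transform_lt.
- move=> x; rewrite ler_norml; apply/andP; split.
    apply: le_trans (c_transform_ge hc x); apply: le_trans (hge _ _).
    have M0 := le_trans (normr_ge0 _) (cM (fun=> point)).
    have B0 := le_trans (normr_ge0 _) (phiB k point).
    have BK : B <= B *+ K.
      by rewrite -[leLHS]mulr1n ler_wpMn2l// (leq_ltn_trans _ nK).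
    by rewrite lerN2; lra.
  have := c_transform_le hc k (dfwith (fun=> point) k x).
  rewrite dfwithin => /le_trans; apply; apply: lerD.
    exact: le_trans (ler_norm _) (cM _).
  rewrite -sumrN; apply: (@le_trans _ _ (\sum_(l < K | l != k) B)).
    by apply: ler_sum => l _; rewrite lerNl.
  rewrite -[in leRHS](card_ord K) -sumr_const [leRHS](bigD1 k)//= lerDr.
  exact: le_trans (normr_ge0 _) (phiB k point).
- exact: c_transform_conj.
Qed.

End c_conjugation.

(** * Attainment of the dual supremum *)

Section dual_attainment.
Context {R : realType} {K : nat} {X : 'I_K -> ptopologicalType}.
Variable mu : forall k, probability (borel (X k)) R.
Variables (c : prod_topology X -> R) (M : R).
Hypotheses (K0 : (0 < K)%N) (c_cont : continuous c) (cM : forall x, `|c x| <= M).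

Let dual := @dual_value R K _ (fun k => borel (X k)) mu.
Let cost_family := @sub_cost R K _ (fun k => borel (X k)) c.
Let bounded := @bounded_family R K _ (fun k => borel (X k)).

(** Truncation sends every competitor into the class bounded by [3 * M] without lowering its value,
    and the c-conjugate family above [phi] reaches the supremum over that class. *)
Lemma dual_attained : exists (g : forall k, X k -> R) (C : R),
  [/\ bounded C g, cost_family g, forall k, c_conj c (g k)
    & forall f, (forall k, (mu k).-integrable [set: borel (X k)] (EFin \o f k)) ->
        cost_family f -> dual f <= dual g].
Proof.
have M0 : 0 <= M by exact: le_trans (normr_ge0 _) (cM (fun=> point)).
(* The constant family [- M] is a starting point: as [K] is at least one and [M] is nonnegative, its
   sum is at most [- M]. *)
have [f0 f0A] : @bounded_sub_cost R K _ (fun k => borel (X k)) c (3 * M) !=set0.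
  have [||g [gB gc _]] := @dual_truncation R K _ (fun k => borel (X k)) mu c M
    (fun k => cst (- M)) K0 cM.
  - move=> k; apply: (@bounded_integrable _ _ _ _ _ `|- M|) => //.
  - move=> x; rewrite sumr_const card_ord.
    have : - M <= c x by have := cM x; rewrite ler_norml => /andP[].
    apply: le_trans; rewrite mulNrn lerN2 -[leLHS]mulr1n ler_wpMn2l//.
  - by exists g.
have [phi [phiB phic phimax]] := dual_limit mu (ex_intro _ f0 f0A).
have [g [gB gc phig gconj]] := c_conjugation c_cont cM phiB phic.
exists g, (M + 3 * M *+ K); split=> // f fi fc.
have [h [hB hc fh]] := @dual_truncation R K _ (fun k => borel (X k)) mu c M f K0 cM fi fc.
apply: (le_trans fh); apply: le_trans (phimax _ _ gB phig).
by apply: dual_value_le_sup => //; exists h.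
Qed.

End dual_attainment.

(** * The superhedging functional *)

Definition bounded_functions (R : realType) (Y : Type) : set (Y -> R) :=
  [set u | exists C, forall x, `|u x| <= C].

Definition normalized_positive_functional (R : realType) (Y : Type)
    (L : (Y -> R) -> R) :=
  [/\ forall a u v, bounded_functions u -> bounded_functions v ->
        L (fun x => a * u x + v x) = a * L u + L v,
      forall u v, bounded_functions u -> bounded_functions v ->
        (forall x, u x <= v x) -> L u <= L v
    & L (cst 1) = 1].

Lemma bounded_functions_lin (R : realType) (Y : Type) a (u v : Y -> R) :
  bounded_functions u -> bounded_functions v ->
  bounded_functions (fun x => a * u x + v x).
Proof.
move=> [C uC] [D vD]; exists (`|a| * C + D) => x.
by rewrite (le_trans (ler_normD _ _))// normrM lerD// ler_wpM2l.
Qed.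


Section superhedging_functional.
Context {R : realType} {K : nat} {d : 'I_K -> measure_display}.
Context {T : forall k, measurableType (d k)}.
Variable P : forall k, probability (T k) R.
Hypothesis K0 : (0 < K)%N.
Local Notation Y := (forall k, T k).
Implicit Types (f : forall k, T k -> R) (u v : Y -> R).

Let K0' : 0 < K%:R :> R. Proof. by rewrite ltr0n. Qed.

Let cst_family a : forall k, T k -> R := fun k => cst (a / K%:R).

Let cst_bounded a : bounded_family `|a / K%:R| (cst_family a).
Proof. by move=> k; split. Qed.

Let sum_cst a (x : Y) : \sum_(k < K) cst_family a (x k) = a.
Proof. by rewrite sumr_const card_ord -[LHS]mulr_natr divfK ?gt_eqF. Qed.

Let dual_cst a : dual_value P (cst_family a) = a.
Proof.
rewrite /dual_value (eq_bigr (fun=> a / K%:R)) => [|k _].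
  by rewrite sumr_const card_ord -[LHS]mulr_natr divfK ?gt_eqF.
exact: Rintegral_probability_cst.
Qed.

(** Each integral is at most the supremum of its component, and [sum_sup_le] adds these suprema up.
    Applied to the opposite family, this bounds the superhedging price from below. *)
Lemma dual_value_le_ub B f (a : R) : bounded_family B f ->
  (forall x : Y, \sum_(k < K) f k (x k) <= a) -> dual_value P f <= a.
Proof.
move=> fB fa.
have fub k : has_ubound (range (f k)).
  by exists B => _ [x _ <-]; exact: le_trans (ler_norm _) ((fB k).2 x).
apply: le_trans (sum_sup_le K0 fub fa); apply: ler_sum => k _.
apply: Rintegral_le_ub; first exact: bounded_family_integrable fB.
by move=> x; apply: ub_le_sup => //; exists x.
Qed.

Let superhedge u : set (forall k, T k -> R) :=
  [set f | (exists B, bounded_family B f)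
         /\ forall x : Y, u x <= \sum_(k < K) f k (x k)].

Let price u : R := inf [set dual_value P f | f in superhedge u].

Let superhedge_neq0 u : bounded_functions u ->
  [set dual_value P f | f in superhedge u] !=set0.
Proof.
move=> [C uC]; exists (dual_value P (cst_family C)), (cst_family C) => //.
split; first by exists `|C / K%:R|; exact: cst_bounded.
by move=> x; rewrite sum_cst (le_trans (ler_norm _)).
Qed.

Let dual_value_ge_lb B f (a : R) : bounded_family B f ->
  (forall x : Y, a <= \sum_(k < K) f k (x k)) -> a <= dual_value P f.
Proof.
move=> fB fa; have := @dual_value_le_ub _ _ (- a) (bounded_familyZ (-1) fB).
rewrite (dual_valueZ P _ fB) mulN1r lerN2; apply => x.
by under eq_bigr do rewrite mulN1r; rewrite sumrN lerN2.
Qed.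

Let price_lb u : bounded_functions u ->
  has_lbound [set dual_value P f | f in superhedge u].
Proof.
move=> [C uC]; exists (- C) => _ [f [[B fB] uf] <-].
apply: (dual_value_ge_lb fB) => x; apply: le_trans (uf x).
by have := uC x; rewrite ler_norml => /andP[].
Qed.

Let price_le u f : bounded_functions u -> superhedge u f ->
  price u <= dual_value P f.
Proof. by move=> ub uf; apply: ge_inf; [exact: price_lb|exists f]. Qed.

Let price_sublinear :
  @sublinear_on R (Y -> R^o) (@bounded_functions R Y) price.
Proof.
split=> [u v ub vb|a u].
  apply: le_infD; [exact: superhedge_neq0|exact: superhedge_neq0|].
  move=> _ _ [f [[B fB] uf] <-] [g [[C gC] vg] <-].
  rewrite -(dual_valueD P fB gC); apply: price_le.
    have [D uD] := ub; have [E vE] := vb; exists (D + E) => x.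
    by rewrite (le_trans (ler_normD _ _))// lerD.
  split; first by exists (B + C); exact: bounded_familyD.
  by move=> x; rewrite big_split/= lerD.
have sb b : bounded_functions u -> bounded_functions (fun x => b * u x).
  move=> [D uD]; exists (`|b| * D) => x; by rewrite normrM ler_wpM2l.
rewrite le_eqVlt => /predU1P[<- ub|a0 ub].
  rewrite mul0r -[leRHS](dual_cst 0); apply: price_le; first exact: sb.
  split; first by exists `|0 / K%:R|; exact: cst_bounded.
  by move=> x; rewrite sum_cst -[leLHS]/(0 * u x) mul0r.
rewrite -ler_pdivrMl//; apply: lb_le_inf; first exact: superhedge_neq0.
move=> _ [f [[B fB] uf] <-]; rewrite ler_pdivrMl// -(dual_valueZ P a fB).
apply: price_le; first exact: sb.
split; first by exists (`|a| * B); exact: bounded_familyZ.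
by move=> x; rewrite -mulr_sumr; apply: ler_wpM2l => //; exact: ltW.
Qed.

(** Hahn-Banach for the price, exact at [- c]. A superhedge of [- c] is the opposite of a family
    below [c], so [- price (- c)] is at most [D]. The zero family superhedges [u - v] when [u <= v],
    which gives monotonicity; the constants 1 and -1 fix [L (cst 1)]. *)
Lemma superhedging_functional (c : Y -> R) (D : R) : bounded_functions c ->
  (forall B f, bounded_family B f -> sub_cost c f -> dual_value P f <= D) ->
  exists L : (Y -> R) -> R, [/\ normalized_positive_functional L,
    forall B f u, bounded_family B f -> bounded_functions u ->
      (forall x : Y, u x <= \sum_(k < K) f k (x k)) -> L u <= dual_value P f
    & L c <= D].
Proof.
move=> cb cD.
have lin a (u v : Y -> R^o) : bounded_functions u -> bounded_functions v ->
  bounded_functions (a *: u + v) by exact: bounded_functions_lin.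
have nb u : bounded_functions u -> bounded_functions (fun x => - u x).
  by move=> [C uC]; exists C => x; rewrite normrN.
have [L [L_lin L_price L_c]] := hahn_banach lin price_sublinear (nb _ cb).
have b0 : bounded_functions (cst 0 : Y -> R) by exists 0 => x; rewrite normr0.
have b1 : bounded_functions (cst 1 : Y -> R) by exists 1 => x; rewrite normr1.
have L0 : L (cst 0) = 0.
  have := L_lin 1 _ _ b0 b0; rewrite (_ : _ + _ = cst 0 :> (Y -> R^o)); first lra.
  by apply/funext => x /=; rewrite -[LHS]/(1 * 0 + 0) mulr0 addr0.
have LN u : bounded_functions u -> L (fun x => - u x) = - L u.
  move=> ub; have := L_lin (-1) _ _ ub b0; rewrite L0 mulN1r => Lu; rewrite -[RHS]addr0 -Lu.
  by congr L; apply/funext => x; rewrite -[RHS]/(-1 * u x + 0) mulN1r addr0.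
have L_le B f u : bounded_family B f -> bounded_functions u ->
    (forall x : Y, u x <= \sum_(k < K) f k (x k)) -> L u <= dual_value P f.
  move=> fB ub uf; apply: le_trans (L_price _ ub) _; apply: price_le => //.
  by split=> //; exists B.
exists L; split=> //; last first.
  rewrite -[leLHS]opprK -LN// L_c lerNl; apply: lb_le_inf.
    exact/superhedge_neq0/nb.
  move=> _ [f [[B fB] cf] <-].
  have := cD _ _ (bounded_familyZ (-1) fB); rewrite (dual_valueZ P _ fB) mulN1r lerNl.
  apply => x; under eq_bigr do rewrite mulN1r.
  by rewrite sumrN lerNl.
split=> // [u v ub vb uv|].
  have : L (fun x => 1 * u x + - v x) <= 0.
    rewrite -[leRHS](dual_cst 0); apply: (L_le _ _ _ (cst_bounded 0)).
      by apply: bounded_functions_lin => //; exact: nb.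
    by move=> x; rewrite sum_cst mul1r subr_le0.
  by have := L_lin 1 _ _ ub (nb _ vb); rewrite LN// => ->; lra.
apply/eqP; rewrite eq_le; apply/andP; split.
  rewrite -[leRHS](dual_cst 1); apply: (L_le _ _ _ (cst_bounded 1)) => // x.
  by rewrite sum_cst.
rewrite -lerN2 -LN// -[leRHS](dual_cst (-1)).
apply: (L_le _ _ _ (cst_bounded (-1))); first exact: nb.
by move=> x; rewrite sum_cst.
Qed.

End superhedging_functional.

(** * Level sets *)

(** For positive [e] the sum is [u] rounded up to a multiple of [e] and capped at [n * e]. The cap
    in the upper bound carries the induction: when a new step is added, the previous sum is at most
    [n * e < u]. *)
Lemma staircase_bounds (R : realType) (e u : R) n : 0 <= e -> 0 <= u ->
  Num.min u (n%:R * e) <= \sum_(i < n) e * (i%:R * e < u)%R%:R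
    <= Num.min (n%:R * e) (u + e).
Proof.
move=> e0 u0; elim: n => [|n ih].
  by rewrite big_ord0 mul0r ge_min lexx orbT le_min lexx addr_ge0.
rewrite big_ord_recr/= -natr1 mulrDl mul1r; move: ih.
set s := \sum_(i < n) _; move: (n%:R * e) => r.
rewrite !ge_min !le_min => /andP[rs /andP[sr su]].
have [ru|ur] := ltP r u; rewrite ?mulr1 ?mulr0 ?addr0.
  have {}rs : r <= s by move: rs; rewrite [u <= s]leNgt (le_lt_trans sr ru).
  by apply/andP; split; [apply/orP; right|apply/andP; split]; lra.
have {}rs : u <= s by case/orP: rs => //; exact: le_trans.
by rewrite rs su /= andbT; lra.
Qed.

Section functional_domination.
Context {R : realType} {Y : ptopologicalType}.
Variables (L : (Y -> R) -> R) (P : probability (borel Y) R).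
Hypothesis L_pos : normalized_positive_functional L.
Hypothesis PL : forall O : set Y, open O -> (P O <= (L \1_O)%:E)%E.

Let bounded_indic (A : set Y) : bounded_functions (\1_A : Y -> R).
Proof. by exists 1 => x; rewrite indicE; case: (_ \in _); rewrite ?normr1 ?normr0. Qed.

Let bounded_cst (a : R) : bounded_functions (cst a : Y -> R).
Proof. by exists `|a|. Qed.

Let step_function (O : nat -> set Y) (e : R) n : Y -> R :=
  fun x => \sum_(i < n) e * \1_(O i) x.

Let step_functionS O e n : step_function O e n.+1 =
  (fun x => e * \1_(O n) x + step_function O e n x).
Proof. by apply/funext => x; rewrite /step_function big_ord_recr/= addrC. Qed.

Let bounded_step_function O e n : bounded_functions (step_function O e n).
Proof.
elim: n => [|n ih].
  by exists 0 => x; rewrite /step_function big_ord0 normr0.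
rewrite step_functionS; exact: bounded_functions_lin.
Qed.

Let borel_open (O : set Y) : open O -> measurable (O : set (borel Y)).
Proof. exact: sub_sigma_algebra. Qed.

Let measurable_step_function O e n : (forall i, open (O i)) ->
  measurable_fun [set: borel Y] (step_function O e n).
Proof.
move=> oO; elim: n => [|n ih].
  rewrite (_ : step_function O e 0 = cst 0); first exact: measurable_cst.
  by apply/funext => x; rewrite /step_function big_ord0.
rewrite step_functionS; apply: measurable_funD => //.
apply: measurable_funM; first exact: measurable_cst.
by apply: measurable_indic; exact: borel_open.
Qed.

Let step_function_integrable O e n : (forall i, open (O i)) ->
  P.-integrable [set: borel Y] (EFin \o step_function O e n).
Proof.
move=> oO; have [C sC] := bounded_step_function O e n.
by apply: (@bounded_integrable _ (borel Y) _ P _ C _ sC); exact: measurable_step_function.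
Qed.

Let integral_step_function_le O e n : 0 <= e -> (forall i, open (O i)) ->
  \int[P]_x step_function O e n x <= L (step_function O e n).
Proof.
move=> e0 oO; have [Llin Lmono L1] := L_pos.
elim: n => [|n ih].
  rewrite (_ : step_function O e 0 = cst 0); last first.
    by apply/funext => x; rewrite /step_function big_ord0.
  rewrite Rintegral_probability_cst.
  have := Llin (-1) _ _ (bounded_cst 1) (bounded_cst 1); rewrite L1.
  rewrite (_ : (fun _ => _) = cst 0); last first.
    by apply/funext => x /=; rewrite mulr1 addNr.
  by move=> ->; rewrite mulr1 addNr.
have mO := borel_open (oO n).
have Oi : P.-integrable [set: borel Y] (EFin \o \1_(O n)).
  have [C OC] := bounded_indic (O n).
  by apply: (@bounded_integrable _ (borel Y) _ P _ C _ OC); exact: measurable_indic.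
rewrite step_functionS Llin// RintegralD//; last 2 first.
- have [C OC] := bounded_functions_lin e (bounded_indic (O n)) (bounded_cst 0).
  apply: (@bounded_integrable _ _ _ _ _ C) => [|x].
    by apply: measurable_funM; [exact: measurable_cst|exact: measurable_indic].
  by have := OC x; rewrite addr0.
- exact: step_function_integrable.
rewrite RintegralZl// lerD// ler_wpM2l// /Rintegral integral_indic// setIT.
by rewrite -lee_fin fineK ?fin_num_measure// PL.
Qed.

(** Strict superlevel sets of [c] are open, so the staircase built on them is a nonnegative
    combination of indicators on which [P] is below [L]. It lies between [c + M] and [c + M + e]. *)
Lemma continuous_integral_le_functional (c : Y -> R) (M : R) :
  continuous c -> (forall x, `|c x| <= M) -> \int[P]_x c x <= L c.
Proof.
move=> cc cM; have [Llin Lmono L1] := L_pos.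
have cM' x : - M <= c x <= M by rewrite -ler_norml.
have M0 : 0 <= M by exact: le_trans (normr_ge0 _) (cM point).
have open_lt (t : R) : open [set x | c x < t].
  by apply: (iffLR (continuousP _) cc [set r | r < t]); exact: open_lt.
have open_gt (t : R) : open [set x | t < c x].
  by apply: (iffLR (continuousP _) cc [set r | t < r]); exact: open_gt.
have mc : measurable_fun [set: borel Y] c by exact: open_sublevel_measurable.
have ci : P.-integrable [set: borel Y] (EFin \o c).
  exact: (@bounded_integrable _ (borel Y) _ P _ _ _ cM).
have bc : bounded_functions c by exists M.
apply/ler_addgt0Pr => e e0.
(* Since [c + M] takes values between 0 and [2 * M], the cap of the staircase then has no effect on
   the lower bound. *)
have [n Mn] : exists n : nat, 2 * M <= n%:R * e.
  have Me0 : 0 <= 2 * M / e by rewrite divr_ge0 ?mulr_ge0// ltW.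
  exists (Num.bound (2 * M / e)); rewrite -ler_pdivrMr//.
  exact/ltW/archi_boundP.
pose O i := [set x | i%:R * e - M < c x].
have oO i : open (O i) by exact: open_gt.
have sE x : step_function O e n x = \sum_(i < n) e * (i%:R * e < c x + M)%R%:R.
  apply: eq_bigr => i _; rewrite indicE; congr (_ * (nat_of_bool _)%:R).
  by rewrite -ltrBlDr; apply/idP/idP => [/set_mem//|?]; exact: mem_set.
have s_ge x : c x + M <= step_function O e n x.
  have cx0 : 0 <= c x + M by have := cM' x; lra.
  have /andP[+ _] := staircase_bounds n (ltW e0) cx0.
  by rewrite -sE => /(le_trans _); apply; rewrite le_min lexx/=; have := cM' x; lra.
have s_le x : step_function O e n x <= c x + M + e.
  have cx0 : 0 <= c x + M by have := cM' x; lra.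
  have /andP[_] := staircase_bounds n (ltW e0) cx0.
  by rewrite -sE le_min => /andP[].
have Mi : P.-integrable [set: borel Y] (EFin \o cst M).
  by apply: (@bounded_integrable _ (borel Y) _ P _ `|M|).
have int_s : \int[P]_x c x + M <= \int[P]_x step_function O e n x.
  rewrite -[X in _ + X](Rintegral_probability_cst P M) -RintegralD//.
  apply: le_Rintegral => //; last exact: step_function_integrable.
  apply: (@bounded_integrable _ _ _ _ _ (M + M)) => [|x].
    exact: measurable_funD.
  by rewrite (le_trans (ler_normD _ _))// lerD// ger0_norm.
have L_s : L (step_function O e n) <= L c + M + e.
  have LE := Llin (M + e) _ _ (bounded_cst 1) bc; rewrite L1 mulr1 in LE.
  rewrite (_ : _ + _ = M + e + L c); last by ring.
  rewrite -LE; apply: Lmono => [||x].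
  - exact: bounded_step_function.
  - by exists (`|M + e| + M) => y; rewrite (le_trans (ler_normD _ _))// lerD2l.
  by have := s_le x; lra.
have := integral_step_function_le n (ltW e0) oO; lra.
Qed.

End functional_domination.

(** * Couplings *)

(* prod_topology has no canonical pointed topological structure. This one is
   deliberately not canonical: it stays convertible to the pointed structure
   through which borel (prod_topology X) elaborates in Defs. *)
Definition prod_ptopology (I : eqType) (X : I -> ptopologicalType) :
    ptopologicalType :=
  HB.pack (prod_topology X) (Pointed.on (forall i, X i)).

Section coordinates.
Context {I : eqType} {X : I -> ptopologicalType}.

Definition coord (i : I) (x : borel (prod_topology X)) : borel (X i) := x i.

Lemma measurable_coord i : measurable_fun setT (@coord i).
Proof.
apply: (@measurability _ _ _ _ setT (@coord i) (@open (X i))) => // _ [V oV <-].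
rewrite setTI; apply: sub_sigma_algebra.
exact: (iffLR (@continuousP (prod_topology X) (X i) (@proj I X i)) (@proj_continuous I X i)).
Qed.

HB.instance Definition _ i :=
  isMeasurableFun.Build _ _ _ _ (@coord i) (@measurable_coord i).

End coordinates.

Section couplings_theory.
Context {R : realType} {K : nat} {X : 'I_K -> ptopologicalType}.
Variable mu : forall k, probability (borel (X k)) R.

Let dual := @dual_value R K _ (fun k => borel (X k)) mu.
Let bounded := @bounded_family R K _ (fun k => borel (X k)).

(** By change of variables, the integral of [f k] against [mu k] is that of [f k] composed with the
    coordinate against [P]; the constraint is then integrated. *)
Lemma weak_duality (c : prod_topology X -> R) (M B : R)
    (P : probability (borel (prod_topology X)) R) (f : forall k, X k -> R) :
  measurable_fun [set: borel (prod_topology X)] c -> (forall x, `|c x| <= M) ->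
  couplings mu P -> bounded B f -> @sub_cost R K _ (fun k => borel (X k)) c f ->
  dual f <= \int[P]_x c x.
Proof.
move=> mc cM PK fB fc.
have ci : P.-integrable setT (EFin \o c) by exact: (@bounded_integrable _ _ _ P _ M).
have fi k : P.-integrable setT (EFin \o (f k \o @coord _ X k)).
  apply: (@bounded_integrable _ _ _ P _ B) => [|x]; last exact: (fB k).2.
  by apply: measurableT_comp (@measurable_coord _ X k); exact: (fB k).1.
rewrite -lee_fin (EFin_Rintegral ci).
rewrite (@dual_value_integrable _ _ _ (fun k => borel (X k)) mu f); last first.
  by move=> k; exact: (@bounded_family_integrable _ _ _ _ mu _ _ k fB).
rewrite (eq_bigr (fun k => \int[P]_x (f k (coord k x))%:E)%E); last first.
  move=> k _; rewrite -(@integral_distribution _ _ _ _ _ P (@coord _ X k) (EFin \o f k))//.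
  - by apply: eq_measure_integral => A mA _; exact: (esym (PK k A mA)).
  - by apply/measurable_EFinP; exact: (fB k).1.
  - exact: (fi k).
rewrite -(@integral_sum _ _ _ P setT measurableT _ (fun k x => (f k (coord k x))%:E) fi).
apply: le_integral => //.
  by apply: (integrable_sum measurableT) => k _; exact: (fi k).
by move=> x _; rewrite sumEFin lee_fin; exact: fc.
Qed.

Lemma dual_value_indic (A : forall k, set (borel (X k))) :
  (forall k, measurable (A k)) ->
  (dual (fun k => \1_(A k)))%:E = (\sum_(k < K) mu k (A k))%E.
Proof.
move=> mA; rewrite -sumEFin; apply: eq_bigr => k _.
by rewrite /Rintegral integral_indic// setIT fineK// fin_num_measure.
Qed.

Lemma bounded_family_indic (A : forall k, set (borel (X k))) :
  (forall k, measurable (A k)) -> bounded 1 (fun k => \1_(A k)).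
Proof.
move=> mA k; split=> [|x]; first exact: measurable_indic.
by rewrite indicE; case: (_ \in _); rewrite ?normr1 ?normr0.
Qed.

Hypothesis polishX : forall k, polish R (X k).
Hypothesis K0 : (0 < K)%N.

Lemma functional_coupling (L : (prod_topology X -> R) -> R) :
  normalized_positive_functional L ->
  (forall B f u, bounded B f -> bounded_functions u ->
     (forall x : prod_topology X, u x <= \sum_(k < K) f k (x k)) -> L u <= dual f) ->
  exists2 P : probability (borel (prod_topology X)) R, couplings mu P
    & forall O : set (prod_topology X), open O -> (P O <= (L \1_O)%:E)%E.
Proof.
move=> Lpos L_le; have [Llin Lmono L1] := Lpos.
have b1 (A : set (prod_topology X)) : bounded_functions (\1_A : _ -> R).
  by exists 1 => x; rewrite indicE; case: (_ \in _); rewrite ?normr1 ?normr0.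
(* Union bound: the indicator of a set covered by the cylinders over the [A k] is superhedged by the
   family of indicators of the [A k]. *)
have L_indic (A : forall k, set (borel (X k))) (U : set (prod_topology X)) :
    (forall k, measurable (A k)) -> (forall x, U x -> exists k, A k (x k)) ->
    ((L \1_U)%:E <= \sum_(k < K) mu k (A k))%E.
  move=> mA UA; rewrite -dual_value_indic// lee_fin.
  apply: (L_le _ _ _ (bounded_family_indic mA)) => // x.
  rewrite [\1_U x]indicE; have [/set_mem/UA[k Ak]|_] := boolP (x \in U); last first.
    by apply: sumr_ge0 => k _; rewrite indicE.
  rewrite (bigD1 k)//= [X in X + _]indicE mem_set// lerDl.
  by apply: sumr_ge0 => l _; rewrite indicE.
have m_ge0 A : 0 <= L \1_A.
  have L0 := Llin (-1) _ _ (b1 setT) (b1 setT).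
  have <- : L (fun x => -1 * \1_[set: prod_topology X] x + \1_[set: prod_topology X] x) = 0.
    by rewrite L0 mulN1r addNr.
  apply: Lmono => // [|x]; first exact: bounded_functions_lin.
  by rewrite mulN1r addNr indicE.
have mU A B : A `&` B = set0 -> L \1_(A `|` B) = L \1_A + L \1_B.
  move=> AB; rewrite -[X in X + _]mul1r -Llin//; congr L; apply/funext => x.
  rewrite !indicE in_setU mul1r.
  have [/set_mem Ax|_] := boolP (x \in A); last by rewrite add0r.
  rewrite (_ : x \in B = false) ?addr0//; apply/negP => /set_mem Bx.
  by have : (A `&` B) x by []; rewrite AB.
have LT : L \1_[set: prod_topology X] = 1 by rewrite indicT.
have closed_borel k (F : set (X k)) : closed F -> measurable (F : set (borel (X k))).
  move=> clF; rewrite -(setCK F); apply: measurableC.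
  by apply: sub_sigma_algebra; exact: closed_openC.
(* A product of compact sets is compact by Tychonoff, and its complement is covered by the cylinders
   over the complements of the [F k], of total mass at most [e]. *)
have tight e : 0 < e -> exists2 C : set (prod_topology X), compact C & 1 - e <= L \1_C.
  move=> e0; have eK : 0 < e / K%:R by rewrite divr_gt0// ltr0n.
  have ulam k := ulam_tight (polishX k) (mu k) eK.
  pose F k := projT1 (cid (ulam k)).
  have FP k : [/\ compact (F k), closed (F k) & (mu k (~` F k) <= (e / K%:R)%:E)%E].
    exact: projT2 (cid (ulam k)).
  exists [set x : prod_topology X | forall k, F k (x k)].
    by apply: (@tychonoff _ X F) => k; have [] := FP k.
  set C := [set _ | _].
  have : ((L \1_(~` C))%:E <= \sum_(k < K) mu k (~` F k))%E.
    apply: L_indic => [k|x /existsNP[k Fk]]; last by exists k.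
    by apply: measurableC; apply: closed_borel; have [] := FP k.
  have : (\sum_(k < K) mu k (~` F k) <= e%:E)%E.
    apply: (@le_trans _ _ (\sum_(k < K) (e / K%:R)%:E)%E).
      by apply: lee_sum => k _; have [] := FP k.
    rewrite sumEFin lee_fin sumr_const card_ord -[leLHS]mulr_natr divfK//.
    by rewrite pnatr_eq0 -lt0n.
  move=> h1 h2; have := le_trans h2 h1; rewrite lee_fin.
  have := mU C (~` C) (setICr C); rewrite setUCr LT; lra.
have [P PL] := @tight_charge_dominates_probability R (prod_ptopology X)
  (@hausdorff_product _ X (fun k => polish_hausdorff (polishX k)))
  (@regular_product _ X (fun k => polish_regular (polishX k)))
  (fun A => L \1_A) m_ge0 mU LT tight.
exists P => // k A mA.
(* Both sides are probabilities, so an inequality on open sets is enough. *)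
apply: (polish_eq_probability (polishX k) (P := distribution P (@coord _ X k))) => // O oO.
have oO' : open (@coord _ X k @^-1` O : set (prod_topology X)).
  exact: (iffLR (@continuousP (prod_topology X) (X k) (@proj _ X k)) (@proj_continuous _ X k)).
apply: (le_trans (PL _ oO')).
(* Empty sets in the other coordinates reduce the union bound to [mu k O]. *)
pose G := dfwith (T := fun l => set (X l)) (fun l => set0) k O.
apply: (@le_trans _ _ (\sum_(l < K) mu l (G l))%E).
  apply: (L_indic G) => [l|x xO].
    have [kl|kl] := eqVneq k l; last by rewrite /G dfwithout//; exact: measurable0.
    by case: l / kl; rewrite /G dfwithin; exact: sub_sigma_algebra.
  by exists k; rewrite /G dfwithin.
rewrite (bigD1 k)//= big1 ?adde0 => [|l lk]; first by rewrite /G dfwithin.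
by rewrite /G dfwithout ?measure0// eq_sym.
Qed.

End couplings_theory.

(** * Strong duality with attainment on both sides *)

Theorem theorem4 (R : realType) (K : nat) (hK : (3 <= K)%N)
    (X : 'I_K -> ptopologicalType) (polishX : forall k, polish R (X k))
    (mu : forall k, probability (borel (X k)) R)
    (c : prod_topology X -> R) (c_continuous : continuous c)
    (c_bounded : exists M : R, forall x, `|c x| <= M) :
  (exists g : forall k, X k -> R,
     [/\ admissible mu c g,
         forall k, c_conj c (g k)
       & forall f, admissible mu c f -> (J mu f <= J mu g)%E]) /\
  is_maximum (J mu @` admissible mu c) (MOT mu c) /\
  is_maximum (J mu @` (admissible mu c `&` all_c_conj c)) (MOT mu c) /\
  is_minimum (cost c @` couplings mu) (MOT mu c).
Proof.
have [M cM] := c_bounded.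
have K0 : (0 < K)%N by exact: leq_trans hK.
pose dual := @dual_value R K _ (fun k => borel (X k)) mu.
have mc : measurable_fun [set: borel (prod_topology X)] c.
  apply: (@open_sublevel_measurable R (prod_ptopology X) c) => t.
  by apply: (iffLR (continuousP _) c_continuous [set r | r < t]); exact: open_lt.
have dualE f : (forall k, (mu k).-integrable [set: borel (X k)] (EFin \o f k)) ->
    J mu f = (dual f)%:E.
  by move=> fi; rewrite /dual (@dual_value_integrable R K _ (fun k => borel (X k)) mu).
have [g [C [gB gc gconj gmax]]] := dual_attained mu K0 c_continuous cM.
have gi k : (mu k).-integrable [set: borel (X k)] (EFin \o g k).
  exact: (@bounded_family_integrable _ _ _ (fun k => borel (X k)) mu _ _ k gB).
have gA : admissible mu c g by split=> [k|]; [exact: (gB k).1|].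
have Jg f : admissible mu c f -> (J mu f <= J mu g)%E.
  by move=> [_ [fi fc]]; rewrite !dualE// lee_fin; exact: gmax.
have costE P : cost c P = (\int[P]_x c x)%:E.
  by rewrite EFin_Rintegral//; exact: (@bounded_integrable _ _ _ P _ M).
have bc : bounded_functions c by exists M.
(* The value of the dual maximizer serves as the bound [D]. *)
have [L [Lpos L_le Lc]] :=
    @superhedging_functional R K _ (fun k => borel (X k)) mu K0 c (dual g) bc
  (fun B f fB fc => gmax f (fun k =>
     @bounded_family_integrable _ _ _ (fun k => borel (X k)) mu _ _ k fB) fc).
have [P PK PO] := functional_coupling polishX K0 Lpos L_le.
have Pg : \int[P]_x c x <= dual g.
  apply: le_trans Lc.
  exact: (@continuous_integral_le_functional R (prod_ptopology X) L P Lpos PO c M).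
(* With [Pg] this closes the chain: [P] costs at most [dual g], and every coupling costs at least
   that much. *)
have gP Q : couplings mu Q -> dual g <= \int[Q]_x c x.
  by move=> QK; exact: weak_duality QK gB gc.
have MOTE : MOT mu c = J mu g.
  rewrite dualE//; apply/eqP; rewrite eq_le; apply/andP; split.
    apply: (@le_trans _ _ (cost c P)); last by rewrite costE lee_fin.
    by apply: ereal_inf_lbound; exists P.
  apply: le_ereal_inf_tmp => _ [Q QK <-].
  by rewrite costE lee_fin gP.
split; first by exists g.
rewrite MOTE; split; [|split].
- by split=> [|_ [f fA <-]]; [exists g|exact: Jg].
- by split=> [|_ [f [fA _] <-]]; [exists g|exact: Jg].
split; last by rewrite -MOTE => m Sm; exact: ereal_inf_lbound.
exists P => //; rewrite costE dualE//.
by apply/eqP; rewrite eqe eq_le Pg gP.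
Qed.
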